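(* Let $m,n\geq 5$, and let $G\cong K_m$ and $H\cong K_n$ be disjointly embedded, weakly linked graphs in $\mathbb{R}^3$. Suppose that there is a vertex $p$ of $G$ common to all triangles of $G$ linking $H$, and a vertex $q$ of $H$ common to all triangles of $H$ linking $G$. Then for some $2\leq\ell\leq\min\{m,n\}-1$, there exist - a partition $\mathcal{X}=\{X_0,X_1,\ldots,X_{\ell-1}\}$ of $G'=G-\{p\}$, such that the triangle $pxy$ of $G$ links $H$ if and only if $x$ and $y$ belong to different parts of $\mathcal{X}$; and - a partition $\mathcal{Y}=\{Y_0,Y_1,\ldots,Y_{\ell-1}\}$ of $H'=H-\{q\}$, such that the triangle $quv$ of $H$ links $G$ if and only if $u$ and $v$ belong to different parts of $\mathcal{Y}$. Moreover: (1) If $x_j\in X_j$, $x_k\in X_k$ for $j<k$, then $px_jx_k$ links $H$ in the star $qO_{jk}I_{jk}$, where $$O_{jk}=\bigcup_{i=j}^{k-1}Y_i,\qquad I_{jk}=H'-O_{jk}=\left(\bigcup_{i=0}^{j-1}Y_i\right)\cup\left(\bigcup_{i=k}^{\ell-1}Y_i\right).$$ (2) If $y_j\in Y_j$, $y_k\in Y_k$ for $j<k$, then $qy_jy_k$ links $G$ in the star $pP_{jk}J_{jk}$, where $$J_{jk}=\bigcup_{i=j+1}^{k}X_i,\qquad P_{jk}=G'-J_{jk}=\left(\bigcup_{i=0}^{j}X_i\right)\cup\left(\bigcup_{i=k+1}^{\ell-1}X_i\right).$$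
   Context: A complete graph and its vertex set are denoted by the same symbol, so $G-S$ denotes the set of vertices of $G$ not in $S$. Parts of a partition are nonempty. An embedded graph is identified with its image in $\mathbb{R}^3$. $\operatorname{Lk}(C,D)$ denotes the linking number of disjoint oriented simple closed curves; $C,D$ are linked if $\operatorname{Lk}(C,D)\neq 0$ and strongly linked if $|\operatorname{Lk}(C,D)|\geq 2$. Disjointly embedded graphs are weakly linked if some cycle in one links a cycle in the other, but no cycle in one strongly links a cycle in the other. A cycle links a graph if it links some cycle of that graph. For distinct vertices $p,q,r$, $pqr$ denotes the oriented triangle $p\to q\to r\to p$, and $-T$ is $T$ reversed. Star: given an ordered partition $(\{p\},O,I)$ of the vertices of a complete graph $K$ into nonempty sets, the star $pOI$ consists of all oriented triangles $pqr$ with $q\in O$, $r\in I$. ''$C$ links $K$ in the star $pOI$'' means that for all oriented triangles $T$ of $K$: $\operatorname{Lk}(C,T)=+1$ if $T\in pOI$, $-1$ if $-T\in pOI$, and $0$ otherwise. *)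

(* Defs.v *)
From HB Require Import structures.
From mathcomp Require Import all_boot all_order all_algebra.
From mathcomp Require Import all_classical all_reals all_analysis.

Set Implicit Arguments.
Unset Strict Implicit.
Unset Printing Implicit Defensive.

Import Order.TTheory GRing.Theory Num.Theory.
Import numFieldNormedType.Exports.

Local Open Scope classical_set_scope.
Local Open Scope ring_scope.

Definition segment_pt {R : realType} {d : nat} (a b : 'rV[R]_d) (s : R) :
  'rV[R]_d := (1 - s) *: a + s *: b.

(* Link diagrams are drawn by projecting R^3 vertically onto the plane of the
   first two coordinates. [wedge u v] is the planar cross product of the
   projections of u and v, and [ez] is the upward unit vector. *)
Definition wedge {R : realType} (u v : 'rV[R]_3) : R :=
  u ord0 (inord 0) * v ord0 (inord 1) - u ord0 (inord 1) * v ord0 (inord 0).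

Definition ez {R : realType} : 'rV[R]_3 := delta_mx ord0 ord_max.

(* In projection, the open segments ]a,b[ and ]c,d[ meet, with ]a,b[ above. *)
Definition crosses_over {R : realType} (a b c d : 'rV[R]_3) : Prop :=
  exists s t h : R, [/\ 0 < s < 1, 0 < t < 1, 0 < h &
    segment_pt a b s = segment_pt c d t + h *: ez].

(* Sign of the crossing of the oriented segment ab over cd: +1 when the upper
   direction turns counterclockwise to the lower one (right-hand convention). *)
Definition crossing {R : realType} (a b c d : 'rV[R]_3) : int :=
  if `[< crosses_over a b c d >] then sgz (wedge (b - a) (d - c)) else 0.

(* A closed polygon is the cyclic sequence of its vertices; [ordS] is the
   cyclic successor, so its edges run from [P i] to [P (ordS i)]. *)
Definition polygon_lk {R : realType} {M N : nat}
    (P : 'I_M -> 'rV[R]_3) (Q : 'I_N -> 'rV[R]_3) : int :=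
  \sum_(i < M) \sum_(j < N) crossing (P i) (P (ordS i)) (Q j) (Q (ordS j)).

(* In projection, no vertex of one polygon is on the line through an edge of
   the other (and no edge is vertical); then all crossings of P with Q are
   transverse and interior to the edges. *)
Definition general_position {R : realType} {M N : nat}
    (P : 'I_M -> 'rV[R]_3) (Q : 'I_N -> 'rV[R]_3) : Prop :=
  forall i j, wedge (P (ordS i) - P i) (Q j - P i) != 0 /\
              wedge (Q (ordS j) - Q j) (P i - Q j) != 0.

Definition approximates {R : realType} (g : R -> 'rV[R]_3) (e : R) {N : nat}
    (P : 'I_N -> 'rV[R]_3) : Prop :=
  forall (i : 'I_N) (t : R), i%:R / N%:R <= t <= i.+1%:R / N%:R ->
    `|P i - g t| < e.

(* The linking number of disjoint closed curves, parametrized by [0, 1], is the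
   number of signed crossings of C over D in a diagram of any sufficiently
   close pair of closed polygons in general position. Equivalently, it is the
   degree of the Gauss map (C s - D t) / |C s - D t| of the torus, counted at
   the vertical direction. No tameness of the curves is assumed. *)
Definition is_linking_number {R : realType} (C D : R -> 'rV[R]_3) (k : int) :
  Prop :=
  exists2 e : R, 0 < e &
    forall (M N : nat) (P : 'I_M.+1 -> 'rV[R]_3) (Q : 'I_N.+1 -> 'rV[R]_3),
      approximates C e P -> approximates D e Q -> general_position P Q ->
      polygon_lk P Q = k.

Definition Lk {R : realType} (C D : R -> 'rV[R]_3) : int :=
  xget 0 [set k | is_linking_number C D k]%classic.

Definition linked {R : realType} (C D : R -> 'rV[R]_3) : Prop := Lk C D <> 0.

Definition strongly_linked {R : realType} (C D : R -> 'rV[R]_3) : Prop :=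
  2 <= `|Lk C D|.

(* The geometric realization of K_m with vertex set 'I_m is the 1-skeleton of
   the standard simplex in R^m: vertex i is the i-th basis vector. *)
Definition complete_graph (R : realType) (m : nat) : set 'rV[R]_m :=
  [set x | [/\ forall i, 0 <= x ord0 i, \sum_i x ord0 i = 1 &
               (#|[pred i | x ord0 i != 0%R]| <= 2)%N]]%classic.
Arguments complete_graph : clear implicits.

(* The domain is compact, so a continuous injection is a homeomorphism onto
   its image. *)
Definition graph_embedding {R : realType} {m : nat}
    (f : 'rV[R]_m -> 'rV[R]_3) : Prop :=
  {within complete_graph R m, continuous f} /\
  {in complete_graph R m &, injective f}.

Definition disjoint_images {R : realType} {m n : nat}
    (f : 'rV[R]_m -> 'rV[R]_3) (g : 'rV[R]_n -> 'rV[R]_3) : Prop :=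
  (f @` complete_graph R m `&` g @` complete_graph R n = set0)%classic.

(* An oriented cycle of a complete graph, as the sequence of its vertices in
   cyclic order (determined up to rotation). *)
Definition is_cycle {m : nat} (c : seq 'I_m) : bool := uniq c && (2 < size c)%N.

(* The closed curve traced by the cycle c under f, each edge being traversed
   affinely in the realization during a time interval of length 1 / size c. *)
Definition cycle_curve {R : realType} {m : nat} (f : 'rV[R]_m -> 'rV[R]_3)
    (c : seq 'I_m) (t : R) : 'rV[R]_3 :=
  let k := size c in
  let b := [seq delta_mx ord0 v | v <- c] : seq 'rV[R]_m in
  let i := Num.truncn (t * k%:R) in
  f (segment_pt b`_(i %% k) b`_(i.+1 %% k) (t * k%:R - i%:R)).

Definition weakly_linked {R : realType} {m n : nat}
    (f : 'rV[R]_m -> 'rV[R]_3) (g : 'rV[R]_n -> 'rV[R]_3) : Prop :=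
  (exists (c : seq 'I_m) (d : seq 'I_n),
      [/\ is_cycle c, is_cycle d & linked (cycle_curve f c) (cycle_curve g d)])
  /\ (forall (c : seq 'I_m) (d : seq 'I_n), is_cycle c -> is_cycle d ->
        ~ strongly_linked (cycle_curve f c) (cycle_curve g d)).

Definition links_graph {R : realType} {n : nat} (C : R -> 'rV[R]_3)
    (g : 'rV[R]_n -> 'rV[R]_3) : Prop :=
  exists2 d : seq 'I_n, is_cycle d & linked C (cycle_curve g d).

(* X_0, ..., X_(l-1) are the distinct parts of a partition of D; the library's
   [partition] requires the parts to be nonempty. *)
Definition labelled_partition {V : finType} {l : nat}
    (X : 'I_l -> {set V}) (D : {set V}) : Prop :=
  injective X /\ finset.partition [set X i | i : 'I_l]%SET D.

(* Membership of an oriented triangle T = [:: a; b; c] in the star pOI: T is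
   pqr, up to rotation, with q in O and r in I. *)
Definition in_star {n : nat} (p : 'I_n) (O I : {set 'I_n}) (T : seq 'I_n) :
  Prop :=
  exists q r, [/\ q \in O, r \in I & exists k, T = rot k [:: p; q; r]].

Definition links_in_star {R : realType} {n : nat} (C : R -> 'rV[R]_3)
    (g : 'rV[R]_n -> 'rV[R]_3) (p : 'I_n) (O I : {set 'I_n}) : Prop :=
  labelled_partition (tnth [tuple [set p]%SET; O; I]) [set: 'I_n]%SET /\
  forall a b c : 'I_n, uniq [:: a; b; c] ->
    let T := [:: a; b; c] in
    [/\ in_star p O I T -> Lk C (cycle_curve g T) = 1,
        in_star p O I (rev T) -> Lk C (cycle_curve g T) = -1 &
        ~ in_star p O I T -> ~ in_star p O I (rev T) ->
          Lk C (cycle_curve g T) = 0].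

(* Main.v *)
(* For polygons close to two disjoint closed curves, the signed crossing count
   does not depend on the polygons. Two approximations of one curve bound a
   strip of triangles so small that each of them is separated by a coordinate
   from every edge of the other polygon Q; a triangle entirely above an edge of Q
   contributes the difference of its planar indicator at the two ends of that
   edge, so its crossings with the closed polygon Q cancel. General position with
   respect to all edges of the strip is obtained by translating Q by (t, t^2, 0)
   with t small.

   Approximating each edge of G and H once and for all by a generic polygonal
   path, Lk becomes a form on pairs of edges, antisymmetric in each edge; it is
   symmetric because the signed planar crossings of two closed polygons, over and
   under together, sum to zero. As every linking triangle contains p
   (resp. q), Lk(pxy, quv) = A(y,v) - A(x,v) - A(y,u) + A(x,u) for an integer
   matrix A, and every linking number of cycles has this form; by weak linking it
   is always in {-1, 0, 1}. Let a0 be a row normalized to 0. Then each row takes at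
   most two consecutive values; let S_x be the set of columns where row x is not
   maximal. For two rows x and y the bound forces S_x and S_y to be nested, so the
   sets S_x form a chain starting at the empty set: X_i collects the rows with the
   i-th set of the chain, and Y_i the columns added from the i-th set to the next. *)

Require Import Defs.
From HB Require Import structures.
From mathcomp Require Import all_boot all_order all_algebra.
From mathcomp Require Import all_classical all_reals all_analysis.
From mathcomp Require Import ring lra zify.

Set Implicit Arguments.
Unset Strict Implicit.
Unset Printing Implicit Defensive.

Import Order.TTheory GRing.Theory Num.Theory.
Import numFieldNormedType.Exports.

Local Open Scope classical_set_scope.
Local Open Scope ring_scope.

(** * Planar crossings *)

Notation cx a := (a ord0 (inord 0 : 'I_3)).
Notation cy a := (a ord0 (inord 1 : 'I_3)).
Notation cz a := (a ord0 (@ord_max 2)).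

Section Planar.
Context {R : realType}.
Implicit Types a b c d e : 'rV[R]_3.

Lemma row3P a b : cx a = cx b -> cy a = cy b -> cz a = cz b -> a = b.
Proof.
move=> h0 h1 h2; apply/rowP => -[[|[|[|//]]] hi].
- by rewrite (_ : Ordinal hi = inord 0) //; apply: val_inj; rewrite /= inordK.
- by rewrite (_ : Ordinal hi = inord 1) //; apply: val_inj; rewrite /= inordK.
- by rewrite (_ : Ordinal hi = ord_max) //; apply: val_inj.
Qed.

Definition orient a b c : R := wedge (b - a) (c - a).

Lemma orientE a b c : orient a b c =
  (cx b - cx a) * (cy c - cy a) - (cy b - cy a) * (cx c - cx a).
Proof. by rewrite /orient /wedge !mxE. Qed.

Lemma orientC a b c : orient b a c = - orient a b c.
Proof. by rewrite !orientE; ring. Qed.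

Definition same_proj a b := cx a = cx b /\ cy a = cy b.

Definition pos01 (x : R) : int := if 0 < x then 1 else 0.

Definition side a b c : int := pos01 (orient a b c).

(* In general position this is the sign of the crossing of ab and cd in
   projection, whichever of them is above. *)
Definition chi a b c d : int :=
  if (0 < orient c d a) (+) (0 < orient c d b)
  then side a b d - side a b c else 0.

(* Degenerate edges are allowed: they never cross anything. *)
Definition avoids a b c := same_proj a b \/ orient a b c != 0.

Lemma sideC a b c : orient a b c != 0 -> side b a c = 1 - side a b c.
Proof.
rewrite /side /pos01 (orientC a b) oppr_gt0.
by case: (ltgtP (orient a b c) 0) => // _ _; rewrite ?subrr ?subr0.
Qed.

Lemma same_projC a b : same_proj a b -> same_proj b a.
Proof. by case=> h1 h2; split. Qed.

Lemma avoidsC a b c : avoids a b c -> avoids b a c.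
Proof.
case=> [/same_projC|h]; first by left.
by right; rewrite orientC oppr_eq0.
Qed.

Lemma same_proj_orient a b c d : same_proj a b -> orient c d a = orient c d b.
Proof. by rewrite !orientE => -[-> ->]. Qed.

Lemma chiC a b c d : avoids a b c -> avoids a b d ->
  chi b a c d = - chi a b c d.
Proof.
rewrite /chi addbC; case: ifP => [h|]; last by rewrite oppr0.
case=> [/(same_proj_orient c d) e|hc]; first by rewrite e addbb in h.
case=> [/(same_proj_orient c d) e|hd]; first by rewrite e addbb in h.
by rewrite (sideC hc) (sideC hd); ring.
Qed.

Lemma chi_swap a b c d : orient c d a != 0 -> orient c d b != 0 ->
  avoids a b c -> avoids a b d -> chi c d a b = - chi a b c d.
Proof.
move=> ha hb hc hd; rewrite /chi /side /pos01.
case: hc => [ab|hc].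
  rewrite (same_proj_orient c d ab) addbb subrr oppr0.
  by case: ifP.
case: hd => [ab|hd].
  rewrite (same_proj_orient c d ab) addbb subrr oppr0.
  by case: ifP.
(* Both sides are the cross product of d - c and b - a; this excludes the sign patterns that would
   break antisymmetry. *)
have e : orient c d b - orient c d a = orient a b c - orient a b d.
  by rewrite !orientE; ring.
move: ha hb hc hd e.
move: (orient c d b) (orient c d a) (orient a b c) (orient a b d) => p q r s.
case: (ltgtP 0 p); case: (ltgtP 0 q); case: (ltgtP 0 r); case: (ltgtP 0 s) => //= *;
  first [lia | exfalso; lra].
Qed.

Definition common_sign (x y z : R) : int :=
  if [&& 0 < x, 0 < y & 0 < z] then 1
  else if [&& x < 0, y < 0 & z < 0] then -1 else 0.

(* The orientation of abc if e projects inside the triangle, and 0 otherwise. *)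
Definition inside a b c e : int :=
  common_sign (orient a b e) (orient b c e) (orient c a e).

(** One vertex of the triangle is alone on its side of the line. The two edges at it, with
    orientations [x] and [z], cross the line; [y] belongs to the opposite edge and, by the relation,
    takes the common sign of [x] and [z] when they agree. *)
Lemma lone_vertex_sign (al be ga x y z : R) : 0 < al -> 0 < be -> 0 < ga ->
  al * y = be * z + ga * x -> x != 0 -> z != 0 ->
  pos01 x + pos01 z =
  common_sign x y z + 1.
Proof.
move=> ha hb hc e hx hz; rewrite /pos01 /common_sign.
have yE : y = al^-1 * (be * z + ga * x) by rewrite -e mulKf ?gt_eqF.
have ia : 0 < al^-1 by rewrite invr_gt0.
case: (ltgtP 0 x) hx => // x0 _; case: (ltgtP 0 z) hz => // z0 _ /=.
- have -> : 0 < y by rewrite yE mulr_gt0 // addr_gt0 // mulr_gt0.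
  by [].
- by rewrite !andbF.
- by rewrite !andbF.
- have -> : y < 0 by rewrite yE pmulr_rlt0 //; nra.
  by [].
Qed.

(** [y], [z], [x] are unnormalized barycentric coordinates, with respect to a, b, c, of a point on a
    line, and [al], [be], [ga] are the values at a, b, c of an affine function vanishing on that
    line: hence the linear relation. The final 0 or 1 does not depend on the point of the line, so
    it cancels between two such points. *)
Lemma tri_sign (al be ga x y z : R) : al != 0 -> be != 0 -> ga != 0 ->
  al * y + be * z + ga * x = 0 ->
  x != 0 \/ al = be -> y != 0 \/ be = ga -> z != 0 \/ ga = al ->
  (if (0 < al) (+) (0 < be) then pos01 x else 0) +
  (if (0 < be) (+) (0 < ga) then pos01 y else 0) +
  (if (0 < ga) (+) (0 < al) then pos01 z else 0) =
  common_sign x y z +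
  (if ((0 < al) == (0 < be)) && ((0 < be) == (0 < ga)) then 0 else 1).
Proof.
move=> hal hbe hga rel hx hy hz.
have sg (u : R) (b : bool) : u != 0 -> (0 < u) = b -> if b then 0 < u else 0 < - u.
  by move=> + <-; case: (ltgtP 0 u) => // h _; rewrite oppr_gt0.
have nz (u v w : R) : u != 0 \/ v = w -> ((0 < v) == (0 < w)) || (u != 0).
  by case=> [->|->]; rewrite ?eqxx ?orbT.
have swap12 : common_sign y x z = common_sign x y z.
  by rewrite /common_sign andbCA (andbCA (y < 0)).
have swap23 : common_sign x z y = common_sign x y z.
  by rewrite /common_sign (andbC (0 < z)) (andbC (z < 0)).
case ea : (0 < al); case eb : (0 < be); case ec : (0 < ga) => /=;
  rewrite ?add0r ?addr0;
  move: (sg _ _ hal ea) (sg _ _ hbe eb) (sg _ _ hga ec) => /= pa pb pc;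
  move: (nz _ _ _ hx) (nz _ _ _ hy) (nz _ _ _ hz);
  rewrite ea eb ec /= => nx ny nzz.
(* All vertices are on one side of the line, so no point of the line is inside the triangle: three
   equal signs contradict the relation. *)
- rewrite /common_sign; case: ifP => [/and3P[px py pz]|_].
    by exfalso; move: (mulr_gt0 pa py) (mulr_gt0 pb pz) (mulr_gt0 pc px); lra.
  case: ifP => [/and3P[px py pz]|//]; move: px py pz; rewrite -!oppr_gt0 => px py pz.
  by exfalso; move: (mulr_gt0 pa py) (mulr_gt0 pb pz) (mulr_gt0 pc px); lra.
- by rewrite -swap12; apply: (@lone_vertex_sign (- ga) be al) => //; lra.
- by rewrite -swap23; apply: (@lone_vertex_sign (- be) al ga) => //; lra.
- by apply: (@lone_vertex_sign al (- be) (- ga)) => //; lra.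
- by apply: (@lone_vertex_sign (- al) be ga) => //; lra.
- by rewrite -swap23; apply: (@lone_vertex_sign be (- al) (- ga)) => //; lra.
- by rewrite -swap12; apply: (@lone_vertex_sign ga (- be) (- al)) => //; lra.
- rewrite /common_sign; case: ifP => [/and3P[px py pz]|_].
    by exfalso; move: (mulr_gt0 pa py) (mulr_gt0 pb pz) (mulr_gt0 pc px); lra.
  case: ifP => [/and3P[px py pz]|//]; move: px py pz; rewrite -!oppr_gt0 => px py pz.
  by exfalso; move: (mulr_gt0 pa py) (mulr_gt0 pb pz) (mulr_gt0 pc px); lra.
Qed.

(** The boundary of a triangle crosses de as often as the planar indicator of the triangle changes
    from d to e: subtract [tri_sign] at d from [tri_sign] at e. *)
Lemma tri_chi a b c d e :
  orient d e a != 0 -> orient d e b != 0 -> orient d e c != 0 ->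
  avoids a b d -> avoids a b e -> avoids b c d -> avoids b c e ->
  avoids c a d -> avoids c a e ->
  chi a b d e + chi b c d e + chi c a d e = inside a b c e - inside a b c d.
Proof.
move=> ha hb hc abd abe bcd bce cad cae.
have av (u v w : 'rV[R]_3) : avoids u v w ->
    orient u v w != 0 \/ orient d e u = orient d e v.
  by case=> [uv|]; [right; apply: same_proj_orient|left].
have := tri_sign ha hb hc _ (av _ _ _ abe) (av _ _ _ bce) (av _ _ _ cae).
have := tri_sign ha hb hc _ (av _ _ _ abd) (av _ _ _ bcd) (av _ _ _ cad).
rewrite -!/(inside _ _ _ _) -!/(side _ _ _) /chi.
move=> /(_ ltac:(rewrite !orientE; ring)) hd /(_ ltac:(rewrite !orientE; ring)) he.
move: hd he.
case: (_ (+) _); case: (_ (+) _); case: (_ (+) _); lia.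
Qed.

End Planar.

(** * Crossings of distant short segments *)

Section Boxes.
Context {R : realType}.
Implicit Types a b c d e z : 'rV[R]_3.

Lemma segment_ptE a b (s : R) i :
  segment_pt a b s ord0 i = (1 - s) * a ord0 i + s * b ord0 i.
Proof. by rewrite /segment_pt !mxE. Qed.

Lemma chi_meet a b c d :
  orient c d a != 0 -> orient c d b != 0 -> avoids a b c -> avoids a b d ->
  chi a b c d != 0 ->
  exists s t : R, [/\ 0 < s < 1, 0 < t < 1,
    cx (segment_pt a b s) = cx (segment_pt c d t) &
    cy (segment_pt a b s) = cy (segment_pt c d t)].
Proof.
move=> ha hb hc hd; rewrite /chi; case: ifP => [hab|]; last by rewrite eqxx.
case: hc => [/(same_proj_orient c d) e|hc]; first by rewrite e addbb in hab.
case: hd => [/(same_proj_orient c d) e|hd]; first by rewrite e addbb in hab.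
move=> hcd; have [D DE'] : exists D, D = orient c d a - orient c d b by eexists.
have DE : D = orient a b d - orient a b c by rewrite DE' !orientE; ring.
have D0 : D != 0.
  by move: ha hb hab; rewrite DE'; case: (ltgtP 0 (orient c d a)) => // ? _;
    case: (ltgtP 0 (orient c d b)) => // ? _ _; apply/eqP; lra.
have itv (p q : R) : p != 0 -> q != 0 -> (0 < p) (+) (0 < q) ->
    0 < p / (p - q) < 1.
  case: (ltgtP 0 p) => // p0 _; case: (ltgtP 0 q) => // q0 _ _.
    rewrite divr_gt0 //; last lra.
    rewrite ltr_pdivrMr; last lra.
    by rewrite mul1r; lra.
  rewrite -mulrNN -invrN divr_gt0 ?oppr_gt0 //; last lra.
  rewrite ltr_pdivrMr; last lra.
  by rewrite mul1r; lra.
have e i : (D - orient c d a) * a ord0 i + orient c d a * b ord0 i =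
           (D + orient a b c) * c ord0 i - orient a b c * d ord0 i ->
    segment_pt a b (orient c d a / D) ord0 i =
    segment_pt c d (- orient a b c / D) ord0 i.
  rewrite !segment_ptE => e; apply: (mulfI D0).
  transitivity ((D - orient c d a) * a ord0 i + orient c d a * b ord0 i).
    by field.
  by rewrite e; field.
(* Cramer's rule: the parameters of the intersection point are ratios of signed areas. *)
exists (orient c d a / D), (- orient a b c / D); split.
- by rewrite DE'; exact: itv.
- have -> : - orient a b c / D = orient a b c / (orient a b c - orient a b d).
    by rewrite DE -[in LHS]opprB invrN mulrNN.
  apply: itv => //; move: hcd; rewrite /side /pos01.
  by case: (0 < _); case: (0 < _).
- by apply: e; rewrite DE' !orientE; ring.
- by apply: e; rewrite DE' !orientE; ring.
Qed.

Definition close (r : R) z a :=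
  [/\ `|cx a - cx z| < r, `|cy a - cy z| < r & `|cz a - cz z| < r].

(** Some single coordinate separates the open boxes of half-width r around z and z', and the same
    coordinate then serves all pairs of their points. *)
Definition apart (r : R) z z' :=
  [\/ 2 * r <= `|cx z - cx z'|, 2 * r <= `|cy z - cy z'| |
      2 * r <= `|cz z - cz z'|].

Lemma convex_gt0 (s u v : R) : 0 <= s <= 1 -> 0 < u -> 0 < v ->
  0 < (1 - s) * u + s * v.
Proof.
move=> /andP[s0 s1] u0 v0; have [s_gt0|s_le0] := ltP 0 s.
  by apply: ltr_wpDl; [apply: mulr_ge0; lra|exact: mulr_gt0].
have -> : s = 0 by lra.
by rewrite subr0 mul1r mul0r addr0.
Qed.

Lemma close_coord (r s x y z : R) : 0 <= s <= 1 -> `|x - z| < r ->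
  `|y - z| < r -> `|(1 - s) * x + s * y - z| < r.
Proof.
move=> s01; rewrite !ltr_norml => /andP[? ?] /andP[? ?].
have lb := @convex_gt0 s (x - z + r) (y - z + r) s01 ltac:(lra) ltac:(lra).
have ub := @convex_gt0 s (r - (x - z)) (r - (y - z)) s01 ltac:(lra) ltac:(lra).
rewrite -subr_gt0 -[X in _ && X]subr_gt0; apply/andP; split.
  by apply: (lt_le_trans lb); rewrite le_eqVlt; apply/orP; left; apply/eqP; ring.
by apply: (lt_le_trans ub); rewrite le_eqVlt; apply/orP; left; apply/eqP; ring.
Qed.

Lemma close_segment r z a b (s : R) : 0 <= s <= 1 -> close r z a -> close r z b ->
  close r z (segment_pt a b s).
Proof.
move=> hs [a0 a1 a2] [b0 b1 b2].
by split; rewrite segment_ptE; apply: close_coord.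
Qed.

(* Points in separated boxes with a common projection are separated
   vertically, and so are all other points of these boxes. *)
Lemma vertical_gap r z z' u w : close r z u -> close r z' w -> apart r z z' ->
  same_proj u w -> 2 * r <= `|cz z - cz z'|.
Proof.
move=> [u0 u1 u2] [w0 w1 w2] [h|h|//] [e0 e1]; exfalso; move: h.
  apply/negP; rewrite -ltNge.
  by move: u0 w0; rewrite e0 !ltr_norml => /andP[? ?] /andP[? ?]; apply/andP; split; lra.
apply/negP; rewrite -ltNge.
by move: u1 w1; rewrite e1 !ltr_norml => /andP[? ?] /andP[? ?]; apply/andP; split; lra.
Qed.

Lemma above_const r z z' u w : close r z u -> close r z' w ->
  2 * r <= `|cz z - cz z'| -> (cz w < cz u) = (cz z' < cz z).
Proof.
move=> [_ _]; rewrite ltr_norml => /andP[? ?] [_ _]; rewrite ltr_norml => /andP[? ?].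
by rewrite ler_normr => /orP[] ?; apply/idP/idP => ?; lra.
Qed.

Lemma ezE : [/\ cx (@ez R) = 0, cy (@ez R) = 0 & cz (@ez R) = 1].
Proof.
have ne k : (k < 2)%N -> ((inord k : 'I_3) == ord_max) = false.
  move=> hk; apply/eqP => /(congr1 val); rewrite /= inordK ?(ltn_trans hk) //.
  by move=> e; rewrite e in hk.
by split; rewrite /ez mxE ?ne // !eqxx.
Qed.

(** Boxes separated by a horizontal coordinate have no common projection, and both sides are 0.
    Boxes separated vertically are one above the other as a whole, so comparing the heights of two
    vertices decides which edge is the upper one. *)
Lemma crossingE r z z' a b c d :
  close r z a -> close r z b -> close r z' c -> close r z' d -> apart r z z' ->
  orient c d a != 0 -> orient c d b != 0 -> avoids a b c -> avoids a b d ->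
  crossing a b c d = if cz c < cz a then chi a b c d else 0.
Proof.
move=> za zb zc zd zz ha hb hc hd.
have inI (s : R) : 0 < s < 1 -> 0 <= s <= 1 by case/andP=> *; apply/andP; split; lra.
rewrite /crossing; case: asboolP => [[s [t [h [s01 t01 h0 e]]]]|nco].
- have E i : segment_pt a b s ord0 i = segment_pt c d t ord0 i + h * (ez ord0 i).
    by rewrite e !mxE.
  have ex : cx (segment_pt a b s) = cx (segment_pt c d t).
    by have [z0 z1 _] := ezE; rewrite E ?z0 ?z1 mulr0 addr0.
  have ey : cy (segment_pt a b s) = cy (segment_pt c d t).
    by have [z0 z1 _] := ezE; rewrite E ?z0 ?z1 mulr0 addr0.
  have ez' : cz (segment_pt a b s) = cz (segment_pt c d t) + h.
    by have [_ _ z2] := ezE; rewrite E z2 mulr1.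
  have zs := close_segment (inI _ s01) za zb.
  have zt := close_segment (inI _ t01) zc zd.
  have gap := vertical_gap zs zt zz (conj ex ey).
  rewrite (above_const za zc gap) -(above_const zs zt gap) ez' ltrDl h0.
  move: ex ey; rewrite !segment_ptE => ex ey {E ez' zs zt gap e}.
  have wE : wedge (b - a) (d - c) = orient a b d - orient a b c.
    by rewrite /orient /wedge !mxE; ring.
  rewrite wE /chi.
  have e1 : (1 - s) * orient c d a + s * orient c d b = 0.
    transitivity ((cx d - cx c) * ((1 - s) * cy a + s * cy b - cy c)
      - (cy d - cy c) * ((1 - s) * cx a + s * cx b - cx c)).
      by rewrite !orientE; ring.
    by rewrite ex ey; ring.
  have e2 : (1 - t) * orient a b c + t * orient a b d = 0.
    transitivity ((cx b - cx a) * ((1 - t) * cy c + t * cy d - cy a)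
      - (cy b - cy a) * ((1 - t) * cx c + t * cx d - cx a)).
      by rewrite !orientE; ring.
    by rewrite -ex -ey; ring.
  move/andP: s01 => [s0 s1]; move/andP: t01 => [t0 t1].
  have -> : (0 < orient c d a) (+) (0 < orient c d b).
    move: ha hb e1; case: (ltgtP 0 (orient c d a)) => // pa _;
    case: (ltgtP 0 (orient c d b)) => // pb _ e1; exfalso; nra.
  case: hc => [ab|hc].
    have o0 x : orient a b x = 0 by rewrite orientE; case: ab => -> ->; ring.
    by rewrite !o0 subrr sgz0 /side o0 o0 subrr.
  case: hd => [ab|hd].
    have o0 x : orient a b x = 0 by rewrite orientE; case: ab => -> ->; ring.
    by rewrite !o0 subrr sgz0 /side o0 o0 subrr.
  move: hc hd e2; rewrite /side /pos01.
  case: (ltgtP 0 (orient a b c)) => // pc _; case: (ltgtP 0 (orient a b d)) => // pd _ e2;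
    try by exfalso; nra.
    by rewrite ltr0_sgz //; lra.
  by rewrite gtr0_sgz //; lra.
- case: ifP => // ca; apply/esym/eqP; apply/negPn/negP => /(chi_meet ha hb hc hd).
  move=> [s [t [s01 t01 ex ey]]]; apply: nco.
  have zs := close_segment (inI _ s01) za zb.
  have zt := close_segment (inI _ t01) zc zd.
  have gap := vertical_gap zs zt zz (conj ex ey).
  exists s, t, (cz (segment_pt a b s) - cz (segment_pt c d t)); split=> //.
    by rewrite subr_gt0 (above_const zs zt gap) -(above_const za zc gap).
  have E i (h : R) : (segment_pt c d t + h *: ez) ord0 i =
      segment_pt c d t ord0 i + h * ez ord0 i by rewrite !mxE.
  have [z0 z1 z2] := ezE; apply: row3P; rewrite E ?(z0, z1) ?mulr0 ?addr0 //.
  by rewrite z2 mulr1 addrC subrK.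
Qed.

Lemma crossingC a b c d : crossing b a c d = - crossing a b c d.
Proof.
rewrite /crossing.
have wE : wedge (a - b) (d - c) = - wedge (b - a) (d - c).
  by rewrite /wedge !mxE; ring.
have E : crosses_over b a c d <-> crosses_over a b c d.
  have sym (u v : 'rV[R]_3) : crosses_over u v c d -> crosses_over v u c d.
    case=> s [t [h [s01 t01 h0 e]]]; exists (1 - s), t, h; split=> //.
      by move/andP: s01 => [? ?]; apply/andP; split; lra.
    by rewrite -e /segment_pt subKr addrC.
  by split; apply: sym.
case: asboolP => [/E|] h; case: asboolP => [|] h' //; first by rewrite wE sgzN.
by case: h; apply/E.
Qed.

Lemma crossingCr a b c d : crossing a b d c = - crossing a b c d.
Proof.
rewrite /crossing.
have wE : wedge (b - a) (c - d) = - wedge (b - a) (d - c).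
  by rewrite /wedge !mxE; ring.
have E : crosses_over a b d c <-> crosses_over a b c d.
  have sym (u v : 'rV[R]_3) : crosses_over a b u v -> crosses_over a b v u.
    case=> s [t [h [s01 t01 h0 e]]]; exists s, (1 - t), h; split=> //.
      by move/andP: t01 => [? ?]; apply/andP; split; lra.
    by rewrite e /segment_pt subKr (addrC (t *: v)).
  by split; apply: sym.
case: asboolP => [/E|] h; case: asboolP => [|] h' //; first by rewrite wE sgzN.
by case: h; apply/E.
Qed.

Lemma crossing_refl a c d : crossing a a c d = 0.
Proof.
rewrite /crossing subrr; case: ifP => // _.
by rewrite /wedge !mxE !mul0r subrr sgz0.
Qed.

End Boxes.

(** * Crossings with a closed polygon *)

Section ClosedPolygons.
Context {R : realType}.
Implicit Types a b c d e z : 'rV[R]_3.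

Lemma chi_gap r z z' a b c d :
  close r z a -> close r z b -> close r z' c -> close r z' d -> apart r z z' ->
  orient c d a != 0 -> orient c d b != 0 -> avoids a b c -> avoids a b d ->
  chi a b c d != 0 -> 2 * r <= `|cz z - cz z'|.
Proof.
move=> za zb zc zd zz ha hb hc hd /(chi_meet ha hb hc hd) [s [t [s01 t01 ex ey]]].
have inI (x : R) : 0 < x < 1 -> 0 <= x <= 1 by case/andP=> *; apply/andP; split; lra.
exact: vertical_gap (close_segment (inI _ s01) za zb)
  (close_segment (inI _ t01) zc zd) zz (conj ex ey).
Qed.

Lemma weighted_sum_neq0 (x y z u v w : R) : common_sign x y z != 0 ->
  0 < u -> 0 < v -> 0 < w -> x * u + y * v + z * w != 0.
Proof.
rewrite /common_sign => h u0 v0 w0; move: h.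
case: ifP => [/and3P[x0 y0 z0] _|_].
  by rewrite gt_eqF // !addr_gt0 // mulr_gt0.
case: ifP => [/and3P[x0 y0 z0] _|//].
have nm (p q : R) : p < 0 -> 0 < q -> p * q < 0 by move=> *; rewrite pmulr_llt0.
by move: (nm _ _ x0 u0) (nm _ _ y0 v0) (nm _ _ z0 w0) => *; rewrite lt_eqF //; lra.
Qed.

(** If a horizontal coordinate separated the boxes, the differences of a, b, c with e in that
    coordinate would have the same sign, and so would their barycentric weights; the relation [rx]
    or [ry] says that the weighted sum is 0. *)
Lemma inside_gap r z z' a b c e : close r z a -> close r z b -> close r z c ->
  close r z' e -> apart r z z' -> inside a b c e != 0 ->
  2 * r <= `|cz z - cz z'|.
Proof.
move=> [a0 a1 _] [b0 b1 _] [c0 c1 _] [e0 e1 _] zz ins.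
have rx : orient a b e * (cx c - cx e) + orient b c e * (cx a - cx e) +
    orient c a e * (cx b - cx e) = 0 by rewrite !orientE; ring.
have ry : orient a b e * (cy c - cy e) + orient b c e * (cy a - cy e) +
    orient c a e * (cy b - cy e) = 0 by rewrite !orientE; ring.
move: a0 b0 c0 e0 a1 b1 c1 e1; rewrite !ltr_norml.
move=> /andP[? ?] /andP[? ?] /andP[? ?] /andP[? ?] /andP[? ?] /andP[? ?] /andP[? ?] /andP[? ?].
case: zz => [||//]; rewrite ler_normr => /orP[] h; exfalso.
- move/eqP: rx; apply/negP; apply: weighted_sum_neq0 => //; lra.
- have : orient a b e * (cx e - cx c) + orient b c e * (cx e - cx a) +
      orient c a e * (cx e - cx b) = 0 by rewrite -oppr0 -[in RHS]rx; ring.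
  by move/eqP; apply/negP; apply: weighted_sum_neq0 => //; lra.
- move/eqP: ry; apply/negP; apply: weighted_sum_neq0 => //; lra.
- have : orient a b e * (cy e - cy c) + orient b c e * (cy e - cy a) +
      orient c a e * (cy e - cy b) = 0 by rewrite -oppr0 -[in RHS]ry; ring.
  by move/eqP; apply/negP; apply: weighted_sum_neq0 => //; lra.
Qed.

Lemma sum_cycle_telescope N (F : 'I_N.+1 -> int) :
  \sum_j (F (ordS j) - F j) = 0.
Proof.
by rewrite sumrB [X in _ - X](reindex_inj (@ordS_inj _)) subrr.
Qed.

Section FixedPolygon.
Variables (N : nat) (Q : 'I_N.+1 -> 'rV[R]_3).

Definition edge_lk a b : int := \sum_j crossing a b (Q j) (Q (ordS j)).

Definition edge_chi a b : int := \sum_j chi a b (Q j) (Q (ordS j)).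

Definition off_edges a := forall j, orient (Q j) (Q (ordS j)) a != 0.

Definition clear_line a b := forall j, avoids a b (Q j).

Definition far_from r z :=
  forall j, exists z', [/\ close r z' (Q j), close r z' (Q (ordS j)) & apart r z z'].

Lemma edge_lkC a b : edge_lk b a = - edge_lk a b.
Proof. by rewrite /edge_lk -sumrN; apply: eq_bigr => j _; exact: crossingC. Qed.

Lemma edge_lk_refl a : edge_lk a a = 0.
Proof. by rewrite /edge_lk big1 // => j _; exact: crossing_refl. Qed.

Lemma edge_lk_tri r z a b c :
  far_from r z -> close r z a -> close r z b -> close r z c ->
  off_edges a -> off_edges b -> off_edges c ->
  clear_line a b -> clear_line b c -> clear_line c a ->
  edge_lk a b + edge_lk b c + edge_lk c a = 0.
Proof.
move=> far za zb zc oa ob oc ab bc ca.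
(* The planar indicator of the triangle, counted only at the vertices of Q below it. Each edge of Q
   contributes the difference of [w] at its ends, and these differences cancel around Q. *)
pose w j := if cz (Q j) < cz a then inside a b c (Q j) else 0.
rewrite -[RHS](sum_cycle_telescope w) /edge_lk -!big_split /=.
apply: eq_bigr => j _; have [z' [z1 z2 zz]] := far j.
do 3 rewrite (crossingE (r := r) (z := z) (z' := z')) //.
rewrite /w.
(* With a vertical gap the whole triangle is on one side of the edge, and [tri_chi] applies; without
   it the separation is horizontal, and every term is 0. *)
have [gap|ngap] := boolP (2 * r <= `|cz z - cz z'|).
  rewrite !(above_const (r := r) (z := z) (z' := z')) //.
  by case: ifP => // _; apply: tri_chi.
have chi0 u v : close r z u -> close r z v -> off_edges u -> off_edges v ->
    clear_line u v -> chi u v (Q j) (Q (ordS j)) = 0.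
  move=> zu zv ou ov uv; apply/eqP/negPn/negP.
  by move/(chi_gap zu zv z1 z2 zz (ou j) (ov j) (uv j) (uv _)); apply/negP.
have ins0 i : close r z' (Q i) -> inside a b c (Q i) = 0.
  move=> zi; apply/eqP/negPn/negP.
  by move/(inside_gap za zb zc zi zz); apply/negP.
by rewrite !chi0 // !ins0 // !if_same.
Qed.

Lemma edge_chi_tri a b c : off_edges a -> off_edges b -> off_edges c ->
  clear_line a b -> clear_line b c -> clear_line c a ->
  edge_chi a b + edge_chi b c + edge_chi c a = 0.
Proof.
move=> oa ob oc ab bc ca.
rewrite -[RHS](sum_cycle_telescope (fun j => inside a b c (Q j))).
rewrite /edge_chi -!big_split /=; apply: eq_bigr => j _; exact: tri_chi.
Qed.

Lemma edge_chiC a b : clear_line a b -> edge_chi b a = - edge_chi a b.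
Proof.
by move=> ab; rewrite /edge_chi -sumrN; apply: eq_bigr => j _; exact: chiC.
Qed.

(* Every edge of a closed polygon is a difference of cones over its first vertex. *)
Lemma sum_edge_chi M (P : 'I_M.+1 -> 'rV[R]_3) :
  (forall i, off_edges (P i)) -> (forall i i', clear_line (P i) (P i')) ->
  \sum_i edge_chi (P i) (P (ordS i)) = 0.
Proof.
move=> oP cP; rewrite -[RHS](sum_cycle_telescope (fun i => edge_chi (P ord0) (P i))).
apply: eq_bigr => i _.
have := edge_chi_tri (oP ord0) (oP i) (oP (ordS i)) (cP _ _) (cP _ _) (cP _ _).
by rewrite (edge_chiC (cP ord0 _)) => h; lia.
Qed.

End FixedPolygon.

(** By [chi_swap], a crossing of Q over P enters [polygon_lk Q P] with the opposite of its [chi].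
    The difference of the two counts is therefore the sum of [chi] over all pairs of edges, which is
    0 by [sum_edge_chi]. *)
Lemma polygon_lkC r M N (P : 'I_M.+1 -> 'rV[R]_3) (Q : 'I_N.+1 -> 'rV[R]_3) :
  0 < r ->
  (forall i, exists z, [/\ close r z (P i), close r z (P (ordS i)) & far_from Q r z]) ->
  (forall i, off_edges Q (P i)) -> (forall i i', clear_line Q (P i) (P i')) ->
  general_position P Q ->
  polygon_lk Q P = polygon_lk P Q.
Proof.
move=> r0 hP oP cP gp; have := sum_edge_chi oP cP.
move/(congr1 (fun k => polygon_lk P Q - k)); rewrite subr0 => <-.
rewrite /polygon_lk exchange_big /= -sumrB; apply: eq_bigr => i _.
rewrite /edge_chi -sumrB; apply: eq_bigr => j _.
have [z [z1 z2 /(_ j) [z' [z3 z4 zz]]]] := hP i.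
have h1 : orient (P i) (P (ordS i)) (Q j) != 0 by case: (gp i j).
have h2 : orient (P i) (P (ordS i)) (Q (ordS j)) != 0 by case: (gp i (ordS j)).
have zz' : apart r z' z.
  by case: zz; rewrite distrC => h; [apply: Or31|apply: Or32|apply: Or33].
rewrite (crossingE (r := r) (z := z') (z' := z)) //; try by right; exact: oP.
rewrite (crossingE (r := r) (z := z) (z' := z')) //; try exact: cP; try exact: oP.
rewrite (chi_swap (oP i j) (oP _ j) (cP _ _ _) (cP _ _ _)).
have [/eqP ->|c0] := boolP (chi (P i) (P (ordS i)) (Q j) (Q (ordS j)) == 0).
  by rewrite oppr0 !if_same subrr.
have gap := chi_gap z1 z2 z3 z4 zz (oP _ _) (oP _ _) (cP _ _ _) (cP _ _ _) c0.
have gap' : 2 * r <= `|cz z' - cz z| by rewrite distrC.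
rewrite (above_const z1 z3 gap) (above_const z3 z1 gap').
case: (ltgtP (cz z) (cz z')) => e; rewrite ?sub0r ?subrr //.
by exfalso; move: gap; rewrite e subrr normr0; lra.
Qed.

End ClosedPolygons.

(** * Generic translations *)

Section GenericShift.
Context {R : realType}.
Implicit Types a b c d e z : 'rV[R]_3.

Lemma quadratic_sign (a b c : R) : a != 0 -> \forall t \near 0^'+,
  a + b * t + c * t ^+ 2 != 0 /\ (0 < a + b * t + c * t ^+ 2) = (0 < a).
Proof.
(* For 0 < t < min(k, 1), the terms b t + c t^2 stay below |a| in absolute value; the summand 1
   keeps the denominator positive. *)
move=> a0; pose k := `|a| / (`|b| + `|c| + 1).
have s0 : 0 < `|b| + `|c| + 1 by rewrite ltr_wpDl // addr_ge0.
have k0 : 0 < k by rewrite divr_gt0 // normr_gt0.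
near=> t.
have t0 : 0 < t by [].
have tk : t < k by near: t; exact: nbhs_right_lt.
have t1 : t < 1 by near: t; apply: nbhs_right_lt.
have small : `|b * t + c * t ^+ 2| < `|a|.
  apply: (@le_lt_trans _ _ ((`|b| + `|c| + 1) * t)); last first.
    by rewrite mulrC -ltr_pdivlMr.
  apply: (le_trans (ler_normD _ _)); rewrite !(normrM _ (t ^+ _)) normrM.
  have h2 : `|t ^+ 2| <= t by rewrite normrX gtr0_norm // expr2 ger_pMl // ltW.
  have := ler_wpM2l (normr_ge0 c) h2.
  rewrite (gtr0_norm t0) !mulrDl mul1r => h3.
  by rewrite -addrA lerD2l (le_trans h3) // lerDl ltW.
move: small; rewrite -addrA; move: (b * t + _) => u.
case: (ltgtP 0 a) a0 => // a0 _.
  by rewrite (gtr0_norm a0) ltr_norml => /andP[? ?]; split; [apply/eqP|]; lra.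
rewrite (ltr0_norm a0) ltr_norml => /andP[? ?].
by split; [apply/eqP|apply/negbTE; rewrite -leNgt]; lra.
Unshelve. all: by end_near. Qed.

Lemma quadratic_neq0 (a b c : R) : a != 0 \/ (b != 0 \/ c != 0) ->
  \forall t \near 0^'+, a + b * t + c * t ^+ 2 != 0.
Proof.
have [-> [/eqP//|]|a0 _] := eqVneq a 0; last first.
  by apply: filterS (quadratic_sign b c a0) => t [].
have [-> [/eqP//|c0]|b0 _] := eqVneq b 0.
  near=> t.
  have t0 : 0 < t by [].
  by rewrite mul0r !add0r mulf_neq0 // expf_neq0 // gt_eqF.
near=> t.
have t0 : 0 < t by [].
have -> : 0 + b * t + c * t ^+ 2 = t * (b + c * t + 0 * t ^+ 2) by ring.
apply: mulf_neq0; first by rewrite gt_eqF.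
near: t.
by apply: filterS (quadratic_sign c 0 b0) => t [].
Unshelve. all: by end_near. Qed.

(** Along this parabola, the orientation of an edge with a point becomes a quadratic polynomial in t
    whose coefficients of t and t^2 are, up to sign, the two horizontal coordinate differences of
    the edge. It is thus nonzero for small t > 0 unless the edge is vertical. Heights do not
    change. *)
Definition shift (t : R) : 'rV[R]_3 := \row_i [:: t; t ^+ 2; 0]`_i.

Lemma shiftE t : [/\ cx (shift t) = t, cy (shift t) = t ^+ 2 & cz (shift t) = 0].
Proof. by split; rewrite mxE ?inordK. Qed.

Lemma orient_shiftr a b c t : orient a b (c + shift t) =
  orient a b c + (cy a - cy b) * t + (cx b - cx a) * t ^+ 2.
Proof.
by rewrite !orientE ![(c + _) _ _]mxE; case: (shiftE t) => -> -> _; ring.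
Qed.

Lemma orient_shiftl a c d t : orient (c + shift t) (d + shift t) a =
  orient c d a + (cy d - cy c) * t + (cx c - cx d) * t ^+ 2.
Proof.
rewrite !orientE ![(c + _) _ _]mxE ![(d + _) _ _]mxE.
by case: (shiftE t) => -> -> _; ring.
Qed.

Lemma not_same_proj a b : ~ same_proj a b -> cy a - cy b != 0 \/ cx b - cx a != 0.
Proof.
move=> ab; rewrite !subr_eq0.
have [e|] := eqVneq (cy a) (cy b); last by left.
by right; apply/eqP => e'; apply: ab.
Qed.

Lemma avoids_shift a b c : \forall t \near 0^'+, avoids a b (c + shift t).
Proof.
have [ab|/not_same_proj ab] := pselect (same_proj a b).
  by apply: nearW => t; left.
have := quadratic_neq0 (or_intror (orient a b c != 0) ab).
by apply: filterS => t h; right; rewrite orient_shiftr.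
Qed.

Lemma off_edge_shift a c d : ~ same_proj c d ->
  \forall t \near 0^'+, orient (c + shift t) (d + shift t) a != 0.
Proof.
move=> cd; have dc : ~ same_proj d c by move/same_projC.
have := quadratic_neq0 (or_intror (orient c d a != 0) (not_same_proj dc)).
by apply: filterS => t h; rewrite orient_shiftl.
Qed.

Lemma close_shift r z c t : 0 < t -> t < r -> t < 1 -> close r z c ->
  close (2 * r) z (c + shift t).
Proof.
move=> t0 tr t1 [h0 h1 h2]; have [e0 e1 e2] := shiftE t.
move: h0 h1 h2; rewrite !ltr_norml => /andP[? ?] /andP[? ?] /andP[? ?].
by split; rewrite mxE ?(e0, e1, e2) ltr_norml; apply/andP; split; nra.
Qed.

Lemma closeW r r' z c : r <= r' -> close r z c -> close r' z c.
Proof. by move=> rr' [h0 h1 h2]; split; apply: lt_le_trans rr'. Qed.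

Lemma apartC r z z' : apart r z z' -> apart r z' z.
Proof.
by case; rewrite distrC => h; [apply: Or31|apply: Or32|apply: Or33].
Qed.

Lemma chi_shift a b c d : orient c d a != 0 -> orient c d b != 0 ->
  orient a b c != 0 -> orient a b d != 0 ->
  \forall t \near 0^'+, chi a b (c + shift t) (d + shift t) = chi a b c d.
Proof.
move=> ha hb hc hd; near=> t; rewrite /chi /side /pos01.
have -> : (0 < orient (c + shift t) (d + shift t) a) = (0 < orient c d a).
  rewrite orient_shiftl; near: t.
  by apply: filterS (quadratic_sign (cy d - cy c) (cx c - cx d) ha) => t [].
have -> : (0 < orient (c + shift t) (d + shift t) b) = (0 < orient c d b).
  rewrite orient_shiftl; near: t.
  by apply: filterS (quadratic_sign (cy d - cy c) (cx c - cx d) hb) => t [].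
have -> : (0 < orient a b (c + shift t)) = (0 < orient a b c).
  rewrite orient_shiftr; near: t.
  by apply: filterS (quadratic_sign (cy a - cy b) (cx b - cx a) hc) => t [].
have -> // : (0 < orient a b (d + shift t)) = (0 < orient a b d).
rewrite orient_shiftr; near: t.
by apply: filterS (quadratic_sign (cy a - cy b) (cx b - cx a) hd) => t [].
Unshelve. all: by end_near. Qed.

End GenericShift.

(** * Invariance of the diagrammatic linking number *)

Section Invariance.
Context {R : realType}.
Implicit Types (C D : R -> 'rV[R]_3).

Definition coord_approx C (r : R) N (P : 'I_N -> 'rV[R]_3) :=
  forall (i : 'I_N) (t : R), i%:R / N%:R <= t <= i.+1%:R / N%:R ->
    close r (C t) (P i).

(** The periodic extension to all natural indices: refinements can then be written with integer
    division, and the closing edge is no special case. *)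
Definition unrolled N (P : 'I_N.+1 -> 'rV[R]_3) (k : nat) : 'rV[R]_3 :=
  P (inord (k %% N.+1)).

Lemma unrolled_ord N (P : 'I_N.+1 -> 'rV[R]_3) (i : 'I_N.+1) : unrolled P i = P i.
Proof. by rewrite /unrolled modn_small // inord_val. Qed.

Lemma unrolled_ordS N (P : 'I_N.+1 -> 'rV[R]_3) (i : 'I_N.+1) :
  unrolled P i.+1 = P (ordS i).
Proof. by rewrite /unrolled; congr P; apply: val_inj; rewrite /= inordK ?ltn_mod. Qed.

Lemma unrolled0 N (P : 'I_N.+1 -> 'rV[R]_3) : unrolled P N.+1 = unrolled P 0.
Proof. by rewrite /unrolled modnn mod0n. Qed.

(** Every vertex is repeated q times, and the degenerate edges this creates contribute 0. Two
    polygons thereby get a common number of vertices. *)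
Lemma sum_refine (V : Type) (X : V -> V -> int) (p : nat -> V) n q :
  (0 < q)%N -> (forall a, X a a = 0) ->
  \sum_(0 <= k < n * q) X (p (k %/ q)%N) (p (k.+1 %/ q)%N) =
  \sum_(0 <= i < n) X (p i) (p i.+1).
Proof.
case: q => // q _ X0; rewrite big_nat_mul; apply: eq_bigr => i _.
rewrite mulSn addnC -{1}[(i * q.+1)%N]add0n big_addn addKn.
rewrite big_nat_recr //= big_nat big1 ?add0r => [|j /andP[_ jq]].
  by rewrite -addSn -mulSn mulnK // addnC divnMDl // divn_small // addn0.
rewrite -addSn !(addnC _ (i * q.+1)%N) !divnMDl // !divn_small ?addn0 //.
exact: ltnW.
Qed.

Section Strip.
Variables (C : R -> 'rV[R]_3) (r : R).
Hypothesis closedC : C 0 = C 1.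

(** The curve is close to a vertex during a closed time interval, so at the time k / K, with K the
    refined number of vertices, it is close to the vertices of indices k - 1 and k. For l = K the
    index wraps around, and [C 0 = C 1] is used. *)
Lemma refined_close M (P : 'I_M.+1 -> 'rV[R]_3) q k l :
  coord_approx C r P -> (0 < q)%N -> (k <= M.+1 * q)%N -> (l <= k <= l.+1)%N ->
  (l < M.+1 * q)%N || (k == l) ->
  close r (C (k%:R / (M.+1 * q)%:R)) (unrolled P (l %/ q)%N).
Proof.
move=> aP q0 kK /andP[lk kl] hl.
have K0 : 0 < (M.+1 * q)%:R :> R by rewrite ltr0n muln_gt0.
have [lK|lK] := ltnP l (M.+1 * q).
  have lM : (l %/ q < M.+1)%N by rewrite ltn_divLR.
  have -> : unrolled P (l %/ q)%N = P (Ordinal lM) by rewrite -unrolled_ord.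
  apply: aP; have M0 : 0 < M.+1%:R :> R by rewrite ltr0n.
  have E x : (x * (M.+1 * q) = x * q * M.+1)%N by rewrite (mulnC M.+1) mulnA.
  apply/andP; split.
    rewrite ler_pdivrMr // mulrAC ler_pdivlMr // -!natrM ler_nat /= E leq_mul2r /=.
    by rewrite (leq_trans (leq_trunc_div _ _)).
  rewrite ler_pdivrMr // mulrAC ler_pdivlMr // -!natrM ler_nat /= E leq_mul2r /=.
  by apply: leq_trans kl _; rewrite ltn_ceil.
have kE : k = (M.+1 * q)%N by apply/eqP; rewrite eqn_leq kK (leq_trans lK).
have lE : l = k by move: hl; rewrite ltnNge lK /= => /eqP.
rewrite lE kE mulnK // divff ?gt_eqF // -closedC unrolled0.
rewrite (unrolled_ord P ord0); apply: aP.
by rewrite mul0r lexx divr_ge0.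
Qed.

Lemma capprox_anchor M (P : 'I_M.+1 -> 'rV[R]_3) i : coord_approx C r P ->
  exists t, [/\ 0 <= t <= 1, close r (C t) (P i) & close r (C t) (P (ordS i))].
Proof.
move=> aP; exists (i.+1%:R / (M.+1 * 1)%:R).
have M0 : 0 < (M.+1 * 1)%:R :> R by rewrite ltr0n.
have iM : (i.+1 <= M.+1 * 1)%N by rewrite muln1 ltn_ord.
split.
- by rewrite divr_ge0 // ler_pdivrMr // mul1r ler_nat.
- rewrite -(unrolled_ord P i) -[X in unrolled P X]divn1.
  by apply: refined_close => //; rewrite ?muln1 ?leqnn ?leqnSn ?ltn_ord.
- rewrite -unrolled_ordS -[X in unrolled P X]divn1.
  by apply: refined_close => //; rewrite ?leqnn ?leqnSn ?eqxx ?orbT.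
Qed.

Lemma polygon_lk_unrolled M N (P : 'I_M.+1 -> 'rV[R]_3) (Q : 'I_N.+1 -> 'rV[R]_3) :
  polygon_lk P Q =
  \sum_(0 <= i < M.+1) edge_lk Q (unrolled P i) (unrolled P i.+1).
Proof.
rewrite big_mkord; apply: eq_bigr => i _.
by rewrite unrolled_ord unrolled_ordS.
Qed.

(* The strip between two polygons close to the same curve is cut into small
   triangles, each of which is far from Q. *)
Lemma polygon_lk_strip M M' N (P : 'I_M.+1 -> 'rV[R]_3) (P' : 'I_M'.+1 -> 'rV[R]_3)
    (Q : 'I_N.+1 -> 'rV[R]_3) :
  coord_approx C r P -> coord_approx C r P' ->
  (forall t, 0 <= t <= 1 -> far_from Q r (C t)) ->
  (forall i, off_edges Q (P i)) -> (forall i, off_edges Q (P' i)) ->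
  (forall i j, clear_line Q (P i) (P j)) ->
  (forall i j, clear_line Q (P i) (P' j)) ->
  (forall i j, clear_line Q (P' i) (P' j)) ->
  polygon_lk P Q = polygon_lk P' Q.
Proof.
move=> aP aP' far oP oP' cPP cPP' cP'P'.
rewrite !polygon_lk_unrolled.
rewrite -(@sum_refine _ (edge_lk Q) (unrolled P) _ M'.+1 isT (edge_lk_refl Q)).
rewrite -(@sum_refine _ (edge_lk Q) (unrolled P') _ M.+1 isT (edge_lk_refl Q)).
rewrite (mulnC M'.+1); set K := (M.+1 * M'.+1)%N.
pose p k := unrolled P (k %/ M'.+1)%N; pose p' k := unrolled P' (k %/ M.+1)%N.
apply/eqP; rewrite -subr_eq0 -sumrB -/K.
(* The rungs joining corresponding vertices of the two polygons telescope to 0, because both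
   polygons are closed. *)
have T0 : \sum_(0 <= k < K) (- edge_lk Q (p k.+1) (p' k.+1) - - edge_lk Q (p k) (p' k)) = 0.
  rewrite (telescope_sumr (fun k => - edge_lk Q (p k) (p' k))) //.
  rewrite /p /p' /K mulnK // mulnC mulnK // !unrolled0 !div0n subrr //.
rewrite -[X in _ == X]T0; apply/eqP; apply: eq_big_nat => k /andP[_ kK].
rewrite -/(p k) -/(p k.+1) -/(p' k) -/(p' k.+1).
have KE : K = (M'.+1 * M.+1)%N by rewrite mulnC.
(* This point of the curve is close to all four corners of the k-th square of the strip. *)
pose z := C (k.+1%:R / K%:R).
have z01 : 0 <= (k.+1%:R / K%:R : R) <= 1.
  have K0 : 0 < K%:R :> R by rewrite ltr0n (leq_ltn_trans _ kK).
  by rewrite divr_ge0 // ler_pdivrMr // mul1r ler_nat.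
have zp : close r z (p k) by apply: refined_close => //; rewrite ?leqnSn ?leqnn ?kK.
have zp1 : close r z (p k.+1).
  by apply: refined_close => //; rewrite ?leqnSn ?leqnn ?eqxx ?orbT.
have zp' : close r z (p' k).
  by rewrite /z KE; apply: refined_close => //; rewrite -?KE ?leqnSn ?leqnn ?kK.
have zp1' : close r z (p' k.+1).
  by rewrite /z KE; apply: refined_close => //; rewrite -?KE ?leqnSn ?leqnn ?eqxx ?orbT.
have cP'P i j : clear_line Q (P' i) (P j) by move=> l; apply: avoidsC; exact: cPP'.
(* A diagonal cuts the square into two triangles, each of boundary sum 0. *)
have t1 := edge_lk_tri (far _ z01) zp zp1 zp1' (oP _) (oP _) (oP' _)
  (cPP _ _) (cPP' _ _) (cP'P _ _).
have t2 := edge_lk_tri (far _ z01) zp zp1' zp' (oP _) (oP' _) (oP' _)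
  (cPP' _ _) (cP'P' _ _) (cP'P _ _).
have a1 := edge_lkC Q (p k) (p' k.+1); have a2 := edge_lkC Q (p k) (p' k).
have a3 := edge_lkC Q (p' k) (p' k.+1).
lia.
Qed.

End Strip.

Definition separated (r : R) C D :=
  forall s t, 0 <= s <= 1 -> 0 <= t <= 1 -> apart r (C s) (D t).

Definition translate N (Q : 'I_N -> 'rV[R]_3) (t : R) (j : 'I_N) := Q j + shift t.

Lemma coord_approxW (r r' : R) C N (P : 'I_N -> 'rV[R]_3) : r <= r' ->
  coord_approx C r P -> coord_approx C r' P.
Proof. by move=> rr' aP i t it; apply: closeW rr' _; exact: aP. Qed.

Lemma coord_approx_translate (r : R) D N (Q : 'I_N -> 'rV[R]_3) t :
  0 < t -> t < r -> t < 1 -> coord_approx D r Q ->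
  coord_approx D (2 * r) (translate Q t).
Proof. by move=> t0 tr t1 aQ j s js; apply: close_shift => //; exact: aQ. Qed.

Lemma far_from_approx (r : R) C D N (Q : 'I_N.+1 -> 'rV[R]_3) : D 0 = D 1 ->
  separated r C D -> coord_approx D r Q ->
  forall s, 0 <= s <= 1 -> far_from Q r (C s).
Proof.
move=> clD sep aQ s s01 j; have [t [t01 h1 h2]] := capprox_anchor clD j aQ.
by exists (D t); split=> //; exact: sep.
Qed.

Lemma general_position_translate M N (P : 'I_M.+1 -> 'rV[R]_3)
    (Q : 'I_N.+1 -> 'rV[R]_3) : general_position P Q ->
  \forall t \near 0^'+, general_position P (translate Q t).
Proof.
move=> gp; apply: filter_forall => i; apply: filter_forall => j.
near=> t; split.
- rewrite -/(orient _ _ _) orient_shiftr; near: t.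
  have [h _] := gp i j.
  apply: filterS (quadratic_sign (cy (P i) - cy (P (ordS i)))
    (cx (P (ordS i)) - cx (P i)) h) => t [] //.
- rewrite -/(orient _ _ _) orient_shiftl; near: t.
  have [_ h] := gp i j.
  apply: filterS (quadratic_sign (cy (Q (ordS j)) - cy (Q j))
    (cx (Q j) - cx (Q (ordS j))) h) => t [] //.
Unshelve. all: by end_near. Qed.

Lemma crossing_general (r : R) C D M N (P : 'I_M.+1 -> 'rV[R]_3)
    (Q : 'I_N.+1 -> 'rV[R]_3) i j : C 0 = C 1 -> D 0 = D 1 ->
  separated r C D -> coord_approx C r P -> coord_approx D r Q ->
  general_position P Q ->
  crossing (P i) (P (ordS i)) (Q j) (Q (ordS j)) =
  if cz (Q j) < cz (P i) then chi (P i) (P (ordS i)) (Q j) (Q (ordS j)) else 0.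
Proof.
move=> clC clD sep aP aQ gp.
have [s [s01 h1 h2]] := capprox_anchor clC i aP.
have [t [t01 h3 h4]] := capprox_anchor clD j aQ.
apply: (crossingE h1 h2 h3 h4 (sep _ _ s01 t01)).
- by case: (gp i j).
- by case: (gp (ordS i) j).
- by right; case: (gp i j).
- by right; case: (gp i (ordS j)).
Qed.

(** A sufficiently small translation preserves the signs of all orientations involved, and [shift]
    leaves heights unchanged. *)
Lemma polygon_lk_translate (r : R) C D M N (P : 'I_M.+1 -> 'rV[R]_3)
    (Q : 'I_N.+1 -> 'rV[R]_3) : 0 < r -> C 0 = C 1 -> D 0 = D 1 ->
  separated (2 * r) C D -> coord_approx C r P -> coord_approx D r Q ->
  general_position P Q ->
  \forall t \near 0^'+, polygon_lk P (translate Q t) = polygon_lk P Q.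
Proof.
move=> r0 clC clD sep aP aQ gp; have rr : r <= 2 * r by lra.
near=> t.
have t0 : 0 < t by [].
have tr : t < r by near: t; exact: nbhs_right_lt.
have t1 : t < 1 by near: t; exact: nbhs_right_lt.
have gpt : general_position P (translate Q t).
  by near: t; exact: general_position_translate.
have chit i j : chi (P i) (P (ordS i)) (translate Q t j) (translate Q t (ordS j)) =
    chi (P i) (P (ordS i)) (Q j) (Q (ordS j)).
  move: i j; near: t; apply: filter_forall => i; apply: filter_forall => j.
  have [? ?] := gp i j; have [_ ?] := gp (ordS i) j; have [? _] := gp i (ordS j).
  exact: chi_shift.
apply: eq_bigr => i _; apply: eq_bigr => j _.
have aP2 := coord_approxW rr aP.
rewrite (crossing_general i j clC clD sep aP2 (coord_approx_translate t0 tr t1 aQ) gpt).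
rewrite (crossing_general i j clC clD sep aP2 (coord_approxW rr aQ) gp) chit.
by rewrite /translate mxE; case: (shiftE t) => _ _ ->; rewrite addr0.
Unshelve. all: by end_near. Qed.

(** One small translate [Q'] of Q is generic for all edges of the strip between P and P', so the
    strip argument applies to it. The last conclusion allows a return from [Q'] to Q when P' and Q
    are already in general position. *)
Lemma polygon_lk_first (r : R) C D M M' N (P : 'I_M.+1 -> 'rV[R]_3)
    (P' : 'I_M'.+1 -> 'rV[R]_3) (Q : 'I_N.+1 -> 'rV[R]_3) :
  0 < r -> C 0 = C 1 -> D 0 = D 1 -> separated (2 * r) C D ->
  coord_approx C r P -> coord_approx C r P' -> coord_approx D r Q ->
  general_position P Q -> (forall i, ~ same_proj (P' i) (P' (ordS i))) ->
  exists Q' : 'I_N.+1 -> 'rV[R]_3, [/\ coord_approx D (2 * r) Q', general_position P' Q',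
    polygon_lk P' Q' = polygon_lk P Q &
    general_position P' Q -> polygon_lk P' Q' = polygon_lk P' Q].
Proof.
move=> r0 clC clD sep aP aP' aQ gp nv; have rr : r <= 2 * r by lra.
have nvQ j : ~ same_proj (Q j) (Q (ordS j)).
  move=> [e0 e1]; have [_ /eqP] := gp ord0 j; apply.
  by rewrite -/(orient _ _ _) orientE e0 e1; ring.
suff [t [t0 tr t1 [sP sP'] [[oP oP'] cPP cPP' cP'P']]] : exists t : R, [/\ 0 < t, t < r, t < 1,
    (polygon_lk P (translate Q t) = polygon_lk P Q /\
     (general_position P' Q -> polygon_lk P' (translate Q t) = polygon_lk P' Q)) &
    [/\ ((forall i, off_edges (translate Q t) (P i)) /\
         (forall i, off_edges (translate Q t) (P' i))),
        (forall i j, clear_line (translate Q t) (P i) (P j)),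
        (forall i j, clear_line (translate Q t) (P i) (P' j)) &
        (forall i j, clear_line (translate Q t) (P' i) (P' j))]].
  have aQ' := coord_approx_translate t0 tr t1 aQ.
  exists (translate Q t); split=> //.
  - move=> i j; split; last exact: oP'.
    by have [/nv//|] := cP'P' i (ordS i) j.
  - rewrite -sP; apply/esym/(@polygon_lk_strip C (2 * r) clC) => //;
      first [exact: coord_approxW aP|exact: coord_approxW aP'|idtac].
    exact: far_from_approx clD sep aQ'.
have off K (F : 'I_K -> 'rV[R]_3) : \forall t \near 0^'+,
    forall i, off_edges (translate Q t) (F i).
  by do 2 apply: filter_forall => ?; exact: off_edge_shift.
have clear K L (F : 'I_K -> 'rV[R]_3) (F' : 'I_L -> 'rV[R]_3) :
    \forall t \near 0^'+, forall i j, clear_line (translate Q t) (F i) (F' j).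
  by do 3 apply: filter_forall => ?; exact: avoids_shift.
have sP' : \forall t \near 0^'+, general_position P' Q ->
    polygon_lk P' (translate Q t) = polygon_lk P' Q.
  have [gp'|ngp] := pselect (general_position P' Q); last by apply: nearW.
  by apply: filterS (polygon_lk_translate r0 clC clD sep aP' aQ gp') => t.
apply: (@filter_ex R (0^'+)); near=> t.
split=> //.
- split; near: t; [exact: polygon_lk_translate r0 clC clD sep aP aQ gp|exact: sP'].
- by split; first split; near: t; (exact: off || exact: clear).
Unshelve. all: by end_near. Qed.

(* The half-turn about the first axis exchanges the roles of the upper and
   lower curves while preserving the crossing signs. *)
Definition half_turn (a : 'rV[R]_3) : 'rV[R]_3 :=
  \row_i [:: cx a; - cy a; - cz a]`_i.

Lemma half_turnE a : [/\ cx (half_turn a) = cx a, cy (half_turn a) = - cy a &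
  cz (half_turn a) = - cz a].
Proof. by split; rewrite mxE ?inordK. Qed.

Lemma wedge_half_turn a b c d :
  wedge (half_turn b - half_turn a) (half_turn d - half_turn c) =
  wedge (d - c) (b - a).
Proof.
by rewrite /wedge !mxE !inordK //=; ring.
Qed.

Lemma crosses_over_half_turn a b c d :
  crosses_over (half_turn c) (half_turn d) (half_turn a) (half_turn b) <->
  crosses_over a b c d.
Proof.
have E i (u v : 'rV[R]_3) (s h : R) : (segment_pt u v s + h *: ez) ord0 i =
    segment_pt u v s ord0 i + h * ez ord0 i by rewrite !mxE.
have [z0 z1 z2] := @ezE R.
have [a0 a1 a2] := half_turnE a; have [b0 b1 b2] := half_turnE b.
have [c0 c1 c2] := half_turnE c; have [d0 d1 d2] := half_turnE d.
split=> -[s [t [h [s01 t01 h0 e]]]]; exists t, s, h; split=> //; apply: row3P;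
  rewrite E !segment_ptE;
  have := congr1 (fun v : 'rV[R]_3 => cx v) e;
  have := congr1 (fun v : 'rV[R]_3 => cy v) e;
  have := congr1 (fun v : 'rV[R]_3 => cz v) e;
  rewrite /= !E !segment_ptE !(z0, z1, z2) ?(a0, b0, c0, d0) ?(a1, b1, c1, d1)
    ?(a2, b2, c2, d2); lra.
Qed.

Lemma polygon_lk_half_turn M N (P : 'I_M -> 'rV[R]_3) (Q : 'I_N -> 'rV[R]_3) :
  polygon_lk (half_turn \o Q) (half_turn \o P) = polygon_lk P Q.
Proof.
rewrite /polygon_lk exchange_big; apply: eq_bigr => i _; apply: eq_bigr => j _.
rewrite /crossing /= wedge_half_turn.
by case: asboolP => [/crosses_over_half_turn|] h; case: asboolP => // h';
  case: h; apply/crosses_over_half_turn.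
Qed.

Lemma general_position_half_turn M N (P : 'I_M -> 'rV[R]_3) (Q : 'I_N -> 'rV[R]_3) :
  general_position P Q -> general_position (half_turn \o Q) (half_turn \o P).
Proof.
move=> gp j i; have [h1 h2] := gp i j; rewrite /= !wedge_half_turn.
have wC (u v : 'rV[R]_3) : wedge u v = - wedge v u by rewrite /wedge; ring.
by split; rewrite wC oppr_eq0.
Qed.

Lemma coord_approx_half_turn C r N (P : 'I_N -> 'rV[R]_3) :
  coord_approx C r P -> coord_approx (half_turn \o C) r (half_turn \o P).
Proof.
move=> aP i t it; have [h0 h1 h2] := aP i t it; rewrite /close /=.
have [-> -> ->] := half_turnE (C t); have [-> -> ->] := half_turnE (P i).
by split=> //; rewrite -opprD normrN.
Qed.

Lemma separated_half_turn (r : R) C D : separated r C D ->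
  separated r (half_turn \o D) (half_turn \o C).
Proof.
move=> sep s t s01 t01; have := sep t s t01 s01; rewrite /apart /=.
have [-> -> ->] := half_turnE (C t); have [-> -> ->] := half_turnE (D s).
rewrite -!opprD !normrN.
by case=> h; [apply: Or31|apply: Or32|apply: Or33]; rewrite distrC.
Qed.

(** First P is replaced by P', then, after a half-turn, the polygon of D by Q'. Each replacement
    asks for a separation of twice its radius, and the first one doubles the radius: hence 4 r. *)
Lemma polygon_lk_invariant (r : R) C D M M' N N' (P : 'I_M.+1 -> 'rV[R]_3)
    (P' : 'I_M'.+1 -> 'rV[R]_3) (Q : 'I_N.+1 -> 'rV[R]_3) (Q' : 'I_N'.+1 -> 'rV[R]_3) :
  0 < r -> C 0 = C 1 -> D 0 = D 1 -> separated (4 * r) C D ->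
  coord_approx C r P -> coord_approx D r Q -> general_position P Q ->
  coord_approx C r P' -> coord_approx D r Q' -> general_position P' Q' ->
  polygon_lk P Q = polygon_lk P' Q'.
Proof.
move=> r0 clC clD sep aP aQ gp aP' aQ' gp'.
have sep2 : separated (2 * r) C D.
  move=> s t s01 t01; case: (sep s t s01 t01) => h;
    [apply: Or31|apply: Or32|apply: Or33]; apply: le_trans h; lra.
have nv i : ~ same_proj (P' i) (P' (ordS i)).
  move=> [e0 e1]; have [/eqP h _] := gp' i ord0; apply: h.
  by rewrite -/(orient _ _ _) orientE e0 e1; ring.
have [Q1 [aQ1 gp1 <- _]] := polygon_lk_first r0 clC clD sep2 aP aP' aQ gp nv.
have nv' j : ~ same_proj (half_turn (Q' j)) (half_turn (Q' (ordS j))).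
  move=> [e0 e1]; have [_ /eqP h] := gp' ord0 j; apply: h.
  move: e0 e1; have [-> -> _] := half_turnE (Q' j).
  have [-> -> _] := half_turnE (Q' (ordS j)) => e0 /oppr_inj e1.
  by rewrite -/(orient _ _ _) orientE e0 e1; ring.
have rr : r <= 2 * r by lra.
(* After the half-turn D is the first curve. The radius is [2 * r] because [Q1] is only known to be
   that close to D. *)
have [X [_ _ e1 e2]] := @polygon_lk_first (2 * r) (half_turn \o D) (half_turn \o C)
  _ _ _ (half_turn \o Q1) (half_turn \o Q') (half_turn \o P') ltac:(lra)
  (congr1 half_turn clD) (congr1 half_turn clC)
  ltac:(rewrite mulrA -natrM; exact: separated_half_turn)
  (coord_approx_half_turn aQ1)
  (coord_approx_half_turn (coord_approxW rr aQ'))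
  (coord_approx_half_turn (coord_approxW rr aP'))
  (general_position_half_turn gp1) nv'.
rewrite -(polygon_lk_half_turn P' Q1) -e1 e2 ?polygon_lk_half_turn //.
exact: general_position_half_turn.
Qed.

End Invariance.

(** * The linking number of two disjoint closed curves *)

Section LinkingNumber.
Context {R : realType}.
Implicit Types (C D : R -> 'rV[R]_3) (a b z : 'rV[R]_3).

Lemma norm_lt_close (r : R) z a : `|a - z| < r <-> close r z a.
Proof.
have E : `|a - z| < r <-> ball z r a by rewrite mx_norm_ball /ball_ distrC.
rewrite E; split=> [[r0 h]|[h0 h1 h2]].
  by split; rewrite distrC; apply: h.
split; first by apply: le_lt_trans h0.
move=> i j; rewrite (ord1 i) /ball /= distrC.
case: j => -[|[|[|//]]] hj.
- by rewrite (_ : Ordinal hj = inord 0) //; apply: val_inj; rewrite /= inordK.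
- by rewrite (_ : Ordinal hj = inord 1) //; apply: val_inj; rewrite /= inordK.
- by rewrite (_ : Ordinal hj = ord_max) //; apply: val_inj.
Qed.

Lemma norm_ge_apart (r : R) z z' : 2 * r <= `|z - z'| -> apart r z z'.
Proof.
move=> h; apply: contrapT => nap; move: h; apply/negP; rewrite -ltNge.
apply/norm_lt_close; split; rewrite ltNge; apply/negP => h; apply: nap;
  by [apply: Or31|apply: Or32|apply: Or33].
Qed.

Lemma approximates_coord C (r : R) N (P : 'I_N -> 'rV[R]_3) :
  approximates C r P <-> coord_approx C r P.
Proof. by split=> h i t it; apply/norm_lt_close; exact: h. Qed.

(** Arbitrarily fine pairs in general position are what makes the linking number unique: without any
    pair at some scale e, every integer would satisfy [is_linking_number] vacuously. *)
Lemma Lk_polygon (r : R) C D M N (P : 'I_M.+1 -> 'rV[R]_3) (Q : 'I_N.+1 -> 'rV[R]_3) :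
  0 < r -> C 0 = C 1 -> D 0 = D 1 -> separated (4 * r) C D ->
  (forall e : R, 0 < e -> exists M' N' (P' : 'I_M'.+1 -> 'rV[R]_3)
     (Q' : 'I_N'.+1 -> 'rV[R]_3), [/\ coord_approx C e P', coord_approx D e Q' &
     general_position P' Q']) ->
  coord_approx C r P -> coord_approx D r Q -> general_position P Q ->
  Lk C D = polygon_lk P Q.
Proof.
move=> r0 clC clD sep fine aP aQ gp; apply: xget_unique => [|k [e e0 ke]].
  exists r => // M' N' P' Q' /approximates_coord aP' /approximates_coord aQ' gp'.
  by apply/esym; apply: (polygon_lk_invariant r0 clC clD sep).
have m0 : 0 < Num.min e r by rewrite lt_min e0.
have [M' [N' [P' [Q' [aP' aQ' gp']]]]] := fine _ m0.
have le_e : Num.min e r <= e by rewrite ge_min lexx.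
have le_r : Num.min e r <= r by rewrite ge_min lexx orbT.
rewrite -(ke _ _ P' Q') //; try by apply/approximates_coord; exact: coord_approxW le_e _.
by apply: (polygon_lk_invariant r0 clC clD sep) => //; exact: coord_approxW le_r _.
Qed.

End LinkingNumber.

(** * Uniform continuity on a compact set and distance of disjoint compact sets *)

Section Compactness.
Context {R : realType}.

(** The near-covering form of compactness turns a d valid around each point into a single one;
    halving e and the local radius leaves room to move the base point. *)
Lemma compact_unif_continuous (U V : normedModType R) (f : U -> V) (K : set U) :
  compact K -> {within K, continuous f} -> forall e : R, 0 < e ->
  exists2 d : R, 0 < d & forall x y, K x -> K y -> `|x - y| < d -> `|f x - f y| < e.
Proof.
move=> /compact_near_coveringP cK cf e e0.
pose P (d : R) (x : U) := K x -> forall y, K y -> `|x - y| < d -> `|f x - f y| < e.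
suff : \forall d \near 0^'+, K `<=` P d.
  move=> h; have [d [d0 hd]] : exists d : R, 0 < d /\ K `<=` P d.
    by apply: (@filter_ex R (0^'+)); near=> d; split=> //; near: d.
  by exists d => // x y Kx; exact: hd.
apply: cK => x Kx.
have [rho rho0 hrho] : exists2 rho : R, 0 < rho &
    forall y, K y -> `|x - y| < rho -> `|f x - f y| < e / 2.
  have /subspace_continuousP/(_ x Kx)/cvgrPdist_lt/(_ (e / 2)) := cf.
  rewrite divr_gt0 // => /(_ isT); rewrite near_withinE => /nbhs_ballP[rho /= rho0 h].
  by exists rho => // y Ky xy; apply: h => //; rewrite -ball_normE.
near=> x' d => Kx' y Ky xy.
have xx' : `|x - x'| < rho / 2.
  near: x'; apply/nbhs_ballP; exists (rho / 2); first by rewrite /= divr_gt0.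
  by move=> z; rewrite -ball_normE.
have dr : d < rho / 2 by near: d; apply: nbhs_right_lt; rewrite divr_gt0.
have h1 : `|f x - f x'| < e / 2 by apply: hrho => //; apply: lt_trans xx' _; lra.
have h2 : `|f x - f y| < e / 2.
  apply: hrho => //; rewrite -(subrKA x').
  apply: le_lt_trans (ler_normD _ _) _; rewrite (splitr rho) ltrD //.
  exact: lt_trans dr.
rewrite -(subrKA (f x)); apply: le_lt_trans (ler_normD _ _) _.
by rewrite (distrC (f x')) (splitr e) ltrD.
Unshelve. all: by end_near. Qed.

Lemma compact_disjoint_gap (V : normedModType R) (A B : set V) :
  compact A -> compact B -> A `&` B = set0 ->
  exists2 d : R, 0 < d & forall x y, A x -> B y -> d <= `|x - y|.
Proof.
move=> cA /compact_near_coveringP cB AB.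
pose P (d : R) (y : V) := forall x, A x -> d <= `|x - y|.
suff : \forall d \near 0^'+, B `<=` P d.
  move=> h; have [d [d0 hd]] : exists d : R, 0 < d /\ B `<=` P d.
    by apply: (@filter_ex R (0^'+)); near=> d; split=> //; near: d.
  by exists d => // x y Ax By; exact: hd.
apply: cB => y By.
have clA : closed A by apply: compact_closed => //; exact: norm_hausdorff.
have [rho rho0 hrho] : exists2 rho : R, 0 < rho & forall x, A x -> rho <= `|y - x|.
  have oA : open (~` A) by exact: closed_openC.
  have nAy : (~` A) y by move=> Ay; have : (A `&` B) y by []; rewrite AB.
  have /nbhs_ballP[rho /= rho0 h] := open_nbhs_nbhs (conj oA nAy).
  exists rho => // x Ax; rewrite leNgt; apply/negP => xy.
  by apply: (h x) => //; rewrite -ball_normE.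
near=> y' d => x Ax.
have yy' : `|y - y'| < rho / 2.
  near: y'; apply/nbhs_ballP; exists (rho / 2); first by rewrite /= divr_gt0.
  by move=> z; rewrite -ball_normE.
have dr : d < rho / 2 by near: d; apply: nbhs_right_lt; rewrite divr_gt0.
have := hrho _ Ax; rewrite -(subrKA y') => h.
have := le_trans h (ler_normD _ _).
rewrite (distrC y') => h'; rewrite -(lerD2l (rho / 2)) (le_trans _ (le_trans h' _)) //.
  by rewrite [leRHS]splitr lerD2l ltW.
by rewrite lerD2r ltW.
Unshelve. all: by end_near. Qed.

End Compactness.

(** * Generic perturbations *)

Section Perturbation.
Context {R : realType}.

(** The i-th point moves towards (i, i^2, 0). No three of these directions are collinear in
    projection, so one parameter t makes all triples of distinct indices generic at once. *)
Definition moment (t : R) (i : nat) : 'rV[R]_3 :=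
  t *: \row_j [:: i%:R; i%:R ^+ 2; 0]`_j.

Lemma momentE t i : [/\ cx (moment t i) = t * i%:R,
  cy (moment t i) = t * i%:R ^+ 2 & cz (moment t i) = 0].
Proof. by split; rewrite !mxE ?inordK //= mulr0. Qed.

(* The leading coefficient in t is the Vandermonde determinant of i, j, k. *)
Lemma orient_moment (a b c : 'rV[R]_3) (i j k : nat) :
  i != j -> j != k -> i != k ->
  \forall t \near 0^'+,
    orient (a + moment t i) (b + moment t j) (c + moment t k) != 0.
Proof.
move=> ij jk ik.
pose v : R := (j%:R - i%:R) * (k%:R - i%:R) * (k%:R - j%:R).
have v0 : v != 0 by rewrite /v !mulf_neq0 // subr_eq0 eqr_nat // eq_sym.
pose w : R := (cx b - cx a) * (k%:R ^+ 2 - i%:R ^+ 2) + (j%:R - i%:R) * (cy c - cy a)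
  - (cy b - cy a) * (k%:R - i%:R) - (j%:R ^+ 2 - i%:R ^+ 2) * (cx c - cx a).
have := @quadratic_neq0 R (orient a b c) w v (or_intror (or_intror v0)).
apply: filterS => t; suff <- : orient (a + moment t i) (b + moment t j) (c + moment t k) =
    orient a b c + w * t + v * t ^+ 2 by [].
have E (x y : 'rV[R]_3) l : (x + y) ord0 l = x ord0 l + y ord0 l by rewrite mxE.
rewrite !orientE !(E _ (moment _ _)) /w /v.
have [-> -> _] := momentE t i; have [-> -> _] := momentE t j.
by have [-> -> _] := momentE t k; ring.
Qed.

Lemma close_moment (e : R) z i : 0 < e ->
  \forall t \near 0^'+, close e z (z + moment t i).
Proof.
move=> e0; pose k : R := i%:R + i%:R ^+ 2 + 1.
have i0 : 0 <= i%:R :> R by [].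
have k0 : 0 < k by rewrite /k; nra.
have ek0 : 0 < e / k by rewrite divr_gt0.
near=> t.
have t0 : 0 < t by [].
have tk : t * k < e by rewrite -ltr_pdivlMr //; near: t; exact: nbhs_right_lt.
have E l : (z + moment t i) ord0 l = z ord0 l + moment t i ord0 l by rewrite mxE.
have [h0 h1 h2] := momentE t i; rewrite /k in tk.
have ti : 0 <= t * i%:R by rewrite mulr_ge0 // ltW.
have tii : 0 <= t * i%:R ^+ 2 by rewrite mulr_ge0 ?sqr_ge0 // ltW.
rewrite !mulrDr mulr1 in tk.
split; rewrite E ?(h0, h1, h2) (addrC (z _ _)) addrK ?normr0 // ger0_norm //; lra.
Unshelve. all: by end_near. Qed.

Lemma generic_sequence (a : nat -> 'rV[R]_3) n (e : R) : 0 < e ->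
  exists b : nat -> 'rV[R]_3, (forall i, (i < n)%N -> close e (a i) (b i)) /\
    forall i j k, (i < n)%N -> (j < n)%N -> (k < n)%N ->
      i != j -> j != k -> i != k -> orient (b i) (b j) (b k) != 0.
Proof.
move=> e0; suff [t [ht1 ht2]] : exists t : R,
   (forall i : 'I_n, close e (a i) (a i + moment t i)) /\
   (forall i j k : 'I_n, (i != j :> nat) && (j != k :> nat) && (i != k :> nat) ->
      orient (a i + moment t i) (a j + moment t j) (a k + moment t k) != 0).
  exists (fun i => a i + moment t i); split=> [i hi|i j k hi hj hk ij jk ik].
    exact: (ht1 (Ordinal hi)).
  by apply: (ht2 (Ordinal hi) (Ordinal hj) (Ordinal hk)); rewrite /= ij jk ik.
apply: (@filter_ex R (0^'+)); near=> t; split; near: t.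
  by apply: filter_forall => i; exact: close_moment.
do 3 apply: filter_forall => ?.
have [/andP[/andP[ij jk] ik]|_] := boolP (_ && _); last exact: nearW.
by apply: filterS (orient_moment _ _ _ ij jk ik) => t h _; exact: h.
Unshelve. all: by end_near. Qed.

Lemma generic_maps (U V : eqType) (f : U -> 'rV[R]_3) (g : V -> 'rV[R]_3)
    (s : seq U) (s' : seq V) (e : R) : 0 < e ->
  exists (f' : U -> 'rV[R]_3) (g' : V -> 'rV[R]_3),
  [/\ {in s, forall x, close e (f x) (f' x)},
      {in s', forall y, close e (g y) (g' y)},
      {in s &, forall x1 x2, x1 != x2 ->
        {in s', forall y, orient (f' x1) (f' x2) (g' y) != 0}} &
      {in s' &, forall y1 y2, y1 != y2 ->
        {in s, forall x, orient (g' y1) (g' y2) (f' x) != 0}}].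
Proof.
move=> e0; pose N := (size s + size s')%N.
pose a i := nth 0 (map f s ++ map g s') i.
have [b [hb1 hb2]] := generic_sequence a N e0.
have iS x : x \in s -> (index x s < size s)%N by rewrite index_mem.
have iS' y : y \in s' -> (index y s' < size s')%N by rewrite index_mem.
have lS x : x \in s -> (index x s < N)%N.
  by move=> xs; rewrite (leq_trans (iS _ xs)) // leq_addr.
have lS' y : y \in s' -> (size s + index y s' < N)%N.
  by move=> ys; rewrite ltn_add2l iS'.
have ne x y : x \in s -> (index x s != size s + index y s')%N.
  by move=> xs; rewrite neq_ltn (leq_trans (iS _ xs)) // leq_addr.
have idx (T : eqType) (l : seq T) x y : index x l = index y l ->
    x \in l -> y \in l -> x = y.
  by move=> exy xl yl; rewrite -(nth_index x xl) exy nth_index.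
(* [index] finds the first occurrence, so a point listed several times is perturbed in one way only;
   the offset [size s] keeps the indices of the two lists distinct. *)
exists (fun x => b (index x s)), (fun y => b (size s + index y s')%N); split.
- move=> x xs /=.
  have -> : f x = a (index x s).
    by rewrite /a nth_cat size_map iS // (nth_map x) ?iS // nth_index.
  by apply: hb1; exact: lS.
- move=> y ys /=.
  have -> : g y = a (size s + index y s')%N.
    rewrite /a nth_cat size_map ltnNge leq_addr /= addKn.
    by rewrite (nth_map y) ?iS' // nth_index.
  by apply: hb1; exact: lS'.
- move=> x1 x2 h1 h2 x12 y ys /=.
  apply: hb2; rewrite ?lS ?lS' ?ne //.
  by apply: contra_neq x12 => /idx; apply.
- move=> y1 y2 h1 h2 y12 x xs /=.
  apply: hb2; rewrite ?lS ?lS' //; try by rewrite eq_sym ne.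
  by rewrite eqn_add2l; apply: contra_neq y12 => /idx; apply.
Qed.

End Perturbation.

(** * The edges of an embedded complete graph *)

Section Skeleton.
Context {R : realType} {m : nat}.
Implicit Types (u v : 'I_m) (s : R).

Definition edge_pt u v s : 'rV[R]_m :=
  segment_pt (delta_mx ord0 u) (delta_mx ord0 v) s.

Lemma edge_ptE u v s i : edge_pt u v s ord0 i = (1 - s) * (i == u)%:R + s * (i == v)%:R.
Proof. by rewrite /edge_pt /segment_pt !mxE !eqxx. Qed.

Lemma edge_pt_sym u v s : edge_pt v u s = edge_pt u v (1 - s).
Proof. by rewrite /edge_pt /segment_pt subKr addrC. Qed.

Lemma edge_pt0 u v : edge_pt u v 0 = delta_mx ord0 u.
Proof. by rewrite /edge_pt /segment_pt subr0 scale1r scale0r addr0. Qed.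

Lemma edge_pt1 u v : edge_pt u v 1 = delta_mx ord0 v.
Proof. by rewrite /edge_pt /segment_pt subrr scale1r scale0r add0r. Qed.

Lemma edge_pt_inj u v s s' : u != v -> edge_pt u v s = edge_pt u v s' -> s = s'.
Proof.
move=> uv /(congr1 (fun x : 'rV_m => x ord0 v)).
by rewrite !edge_ptE eqxx [v == u]eq_sym (negbTE uv) !mulr0 !add0r !mulr1.
Qed.

Lemma edge_pt_lipschitz u v s s' : `|edge_pt u v s - edge_pt u v s'| <= 2 * `|s - s'|.
Proof.
have d1 w : `|delta_mx ord0 w : 'rV[R]_m| <= 1.
  rewrite /Num.norm /= mx_normrE; apply: bigmax_le => // -[i j] _ /=.
  by rewrite mxE normr_nat lern1 leq_b1.
have -> : edge_pt u v s - edge_pt u v s' =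
    (s - s') *: (delta_mx ord0 v - delta_mx ord0 u).
  by apply/rowP => i; rewrite !mxE; ring.
rewrite normrZ mulrC ler_wpM2r //.
by apply: le_trans (ler_normB _ _) _; rewrite -[2]/(1 + 1) lerD.
Qed.

(** A finite union of arcs, which makes compactness direct; every curve of a cycle runs in its
    image. *)
Definition skeleton : set 'rV[R]_m :=
  [set x | exists u v s, 0 <= s <= 1 /\ x = edge_pt u v s].

Lemma skeleton_edge_pt u v s : 0 <= s <= 1 -> skeleton (edge_pt u v s).
Proof. by move=> s01; exists u, v, s. Qed.

Lemma skeleton_complete : skeleton `<=` complete_graph R m.
Proof.
move=> _ [u [v [s [/andP[s0 s1] ->]]]]; split.
- by move=> i; rewrite edge_ptE addr_ge0 // mulr_ge0 // subr_ge0.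
- under eq_bigr => i _ do rewrite edge_ptE.
  have sum1 (w : 'I_m) : \sum_i (i == w)%:R = 1 :> R.
    by rewrite (bigD1 w) //= eqxx big1 ?addr0 // => i /negbTE ->.
  by rewrite big_split /= -!mulr_sumr !sum1 !mulr1 subrK.
- apply: (@leq_trans #|[set u; v]%SET|); last by rewrite cards2; case: (u != v).
  apply: subset_leq_card; apply/fintype.subsetP => i; rewrite !inE edge_ptE.
  by apply: contraR; rewrite negb_or => /andP[/negbTE -> /negbTE ->]; rewrite !mulr0 addr0.
Qed.

Lemma compact_skeleton : compact skeleton.
Proof.
apply/compact_near_coveringP => I F P FF h.
have cuv (p : 'I_m * 'I_m) : \forall i \near F, forall s, 0 <= s <= 1 ->
    P i (edge_pt p.1 p.2 s).
  have cE : compact (edge_pt p.1 p.2 @` `[0, 1]).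
    apply: continuous_compact; last exact: segment_compact.
    apply: continuous_subspaceT => s; apply/cvgrPdist_lt => e e0.
    near=> s'; apply: le_lt_trans (edge_pt_lipschitz _ _ _ _) _.
    rewrite -ltr_pdivlMl //; near: s'; apply/nbhs_ballP.
    exists (2^-1 * e) => /=; first by rewrite mulr_gt0 // invr_gt0.
    by move=> x; rewrite /ball /=.
  have /compact_near_coveringP cE' := cE.
  have : \forall i \near F, (edge_pt p.1 p.2 @` `[0, 1]) `<=` P i.
    apply: cE' => x [s hs <-]; apply: h; apply: skeleton_edge_pt.
    by move: hs; rewrite /= in_itv.
  by apply: filterS => i hi s s01; apply: hi; exists s => //; rewrite /= in_itv.
apply: filterS (filter_forall FF cuv) => i hi _ [u [v [s [s01 ->]]]].
exact: (hi (u, v)).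
Unshelve. all: by end_near. Qed.

Lemma edge_unif_continuous (f : 'rV[R]_m -> 'rV[R]_3) (e : R) :
  {within complete_graph R m, continuous f} -> 0 < e ->
  exists2 d : R, 0 < d & forall u v s s', 0 <= s <= 1 -> 0 <= s' <= 1 ->
    `|s - s'| < d -> close e (f (edge_pt u v s)) (f (edge_pt u v s')).
Proof.
move=> cf e0.
have cf' := continuous_subspaceW skeleton_complete cf.
have [d d0 hd] := compact_unif_continuous compact_skeleton cf' e0.
exists (2^-1 * d); first by rewrite mulr_gt0 // invr_gt0.
move=> u v s s' s01 s01'; rewrite ltr_pdivlMl // => ss.
apply/norm_lt_close; rewrite distrC; apply: hd; try exact: skeleton_edge_pt.
exact: le_lt_trans (edge_pt_lipschitz _ _ _ _) ss.
Qed.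

End Skeleton.

Lemma embedding_gap (R : realType) (m n : nat) (G : 'rV[R]_m -> 'rV[R]_3)
    (H : 'rV[R]_n -> 'rV[R]_3) :
  {within complete_graph R m, continuous G} ->
  {within complete_graph R n, continuous H} -> disjoint_images G H ->
  exists2 r : R, 0 < r & forall u v x y s t, 0 <= s <= 1 -> 0 <= t <= 1 ->
    apart r (G (edge_pt u v s)) (H (edge_pt x y t)).
Proof.
move=> cG cH GH.
have kG := continuous_compact (continuous_subspaceW (@skeleton_complete R m) cG)
  compact_skeleton.
have kH := continuous_compact (continuous_subspaceW (@skeleton_complete R n) cH)
  compact_skeleton.
have [|d d0 hd] := compact_disjoint_gap kG kH.
  rewrite -subset0 => z [[x hx xz] [y hy yz]]; rewrite -GH.
  by split; [exists x|exists y] => //; exact: skeleton_complete.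
exists (2^-1 * d); first by rewrite mulr_gt0 // invr_gt0.
move=> u v x y s t s01 t01; apply: norm_ge_apart; rewrite mulVKf //.
by apply: hd; [exists (edge_pt u v s)|exists (edge_pt x y t)] => //;
  exact: skeleton_edge_pt.
Qed.

(** * Polygonal approximation of cycles *)

Section Cycles.
Context {R : realType} {m : nat}.
Variable x0 : 'I_m.
Implicit Types (c : seq 'I_m) (f : 'rV[R]_m -> 'rV[R]_3).

Definition vtx c (a : nat) : 'I_m := nth x0 c (a %% size c).

Lemma cycle_curve_edge f c a (s : R) : (a < size c)%N -> 0 <= s <= 1 ->
  cycle_curve f c ((a%:R + s) / (size c)%:R) = f (edge_pt (vtx c a) (vtx c a.+1) s).
Proof.
move=> ac /andP[s0 s1]; have c0 : (0 < size c)%N by exact: leq_ltn_trans ac.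
have bE i : ([seq delta_mx ord0 v | v <- c] : seq 'rV[R]_m)`_(i %% size c) =
    delta_mx ord0 (vtx c i).
  by rewrite (nth_map x0) // ltn_mod.
rewrite /cycle_curve mulfVK ?pnatr_eq0 -?lt0n // !bE.
have [s_lt1|s_ge1] := ltP s 1.
  have -> : Num.truncn (a%:R + s) = a.
    by apply: truncn_def; rewrite lerDl s0 -natr1 ltrD2l.
  by rewrite addrC addKr.
(* At s = 1 the truncation has already jumped to the next edge, which starts at the same point. *)
have -> : s = 1 by apply/eqP; rewrite eq_le s1.
by rewrite natr1 natrK subrr -!/(edge_pt _ _ _) edge_pt0 edge_pt1.
Qed.

Lemma cycle_curve_range f c (t : R) : (0 < size c)%N -> 0 <= t <= 1 ->
  exists u v s, 0 <= s <= 1 /\ cycle_curve f c t = f (edge_pt u v s).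
Proof.
move=> c0 /andP[t0 t1]; have k0 : 0 < (size c)%:R :> R by rewrite ltr0n.
have tk0 : 0 <= t * (size c)%:R by rewrite mulr_ge0 // ltW.
have /andP[h1 h2] := truncn_itv tk0.
have [lt_c|ge_c] := ltnP (Num.truncn (t * (size c)%:R)) (size c).
  set a := Num.truncn _ in h1 h2 lt_c.
  exists (vtx c a), (vtx c a.+1), (t * (size c)%:R - a%:R).
  have hs : 0 <= t * (size c)%:R - a%:R <= 1.
    by rewrite subr_ge0 h1 lerBlDr nat1r ltW.
  by split=> //; rewrite -cycle_curve_edge // addrC subrK mulfK // gt_eqF.
have tE : t = 1.
  apply/eqP; rewrite eq_le t1 -(ler_pM2r k0) mul1r.
  by apply: le_trans h1; rewrite ler_nat.
exists (vtx c (size c).-1), (vtx c (size c).-1.+1), 1; rewrite ler01 lexx; split=> //.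
have lc : ((size c).-1 < size c)%N by rewrite prednK.
have s01 : 0 <= (1 : R) <= 1 by rewrite ler01 lexx.
rewrite -(cycle_curve_edge f lc s01) tE.
by rewrite -[in RHS](natrD _ _ 1) addn1 prednK // divff // gt_eqF.
Qed.

Lemma cycle_curve_closed f c : (0 < size c)%N -> cycle_curve f c 0 = cycle_curve f c 1 :> 'rV[R]_3.
Proof.
move=> c0; have k0 : (size c)%:R != 0 :> R by rewrite pnatr_eq0 -lt0n.
have -> : 1 = ((size c).-1%:R + 1) / (size c)%:R :> R by rewrite natr1 prednK // divff.
have {1}-> : 0 = (0%:R + 0) / (size c)%:R :> R by rewrite addr0 mul0r.
rewrite !cycle_curve_edge ?ler01 ?lexx ?prednK // edge_pt0 edge_pt1.
by rewrite /vtx modnn mod0n.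
Qed.

Definition cycle_sum c (F : 'I_m -> 'I_m -> int) := \sum_(x <- c) F x (next c x).

Lemma next_vtx c a : uniq c -> (0 < size c)%N -> next c (vtx c a) = vtx c a.+1.
Proof.
move=> uc c0; have -> : vtx c a.+1 = vtx c (a %% size c).+1.
  by rewrite /vtx -(addn1 (a %% _)) modnDml addn1.
rewrite /vtx; move: (ltn_pmod a c0); move: (a %% size c)%N => {}a ac.
rewrite next_nth mem_nth //.
case: c uc ac {c0} => // y c' uc ac; rewrite index_uniq // /vtx /=.
have [h|h] := ltnP a.+1 (size c').+1.
  by rewrite modn_small //=; apply: set_nth_default.
have -> : a.+1 = (size c').+1 by apply/eqP; rewrite eqn_leq ac h.
rewrite modnn /= nth_default //; exact: h.
Qed.

Lemma cycle_sumE c F : uniq c ->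
  cycle_sum c F = \sum_(0 <= a < size c) F (vtx c a) (vtx c a.+1).
Proof.
move=> uc; rewrite /cycle_sum (big_nth x0); apply: eq_big_nat => a /andP[_ ac].
have -> : nth x0 c a = vtx c a by rewrite /vtx modn_small.
by rewrite next_vtx // (leq_ltn_trans _ ac).
Qed.

Lemma cycle_vtx_neq c a : is_cycle c -> vtx c a != vtx c a.+1.
Proof.
move=> /andP[uc sc]; have c0 : (0 < size c)%N by exact: ltn_trans sc.
rewrite /vtx nth_uniq ?ltn_mod //.
rewrite -{1}[a]addn0 -addn1 eqn_modDl mod0n modn_small //; exact: ltn_trans sc.
Qed.

Variable K : nat.
Hypothesis K_gt0 : (0 < K)%N.

Definition mesh_pt u v r : 'rV[R]_m := edge_pt u v (r%:R / K%:R).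

(** The subdivision points of all edges together: they are perturbed once, so an edge is
    approximated by the same path in every cycle containing it. *)
Definition mesh : seq 'rV[R]_m :=
  [seq mesh_pt p.1.1 p.1.2 p.2 | p : 'I_m * 'I_m * 'I_K.+1 <- enum {: 'I_m * 'I_m * 'I_K.+1}].

Lemma mem_mesh u v r : (r <= K)%N -> mesh_pt u v r \in mesh.
Proof.
move=> rK; apply/mapP; exists (u, v, Ordinal (rK : (r < K.+1)%N)) => //.
by rewrite mem_enum.
Qed.

Lemma mesh_pt_itv r : (r <= K)%N -> 0 <= (r%:R / K%:R : R) <= 1.
Proof. by move=> rK; rewrite divr_ge0 // ler_pdivrMr ?ltr0n // mul1r ler_nat. Qed.

Lemma mesh_pt0 u v : mesh_pt u v 0 = delta_mx ord0 u.
Proof. by rewrite /mesh_pt mul0r edge_pt0. Qed.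

Lemma mesh_ptK u v : mesh_pt u v K = delta_mx ord0 v.
Proof. by rewrite /mesh_pt divff ?edge_pt1 // pnatr_eq0 -lt0n. Qed.

Lemma mesh_pt_sym u v r : (r <= K)%N -> mesh_pt v u r = mesh_pt u v (K - r).
Proof.
move=> rK; rewrite /mesh_pt edge_pt_sym; congr edge_pt.
by rewrite natrB // mulrBl divff // pnatr_eq0 -lt0n.
Qed.

Definition cycle_pt c i := mesh_pt (vtx c (i %/ K)) (vtx c (i %/ K).+1) (i %% K).

(** The last subdivision point of an edge is the first one of the next edge, so the successor can
    always be written on the edge of its predecessor. *)
Lemma cycle_ptS c i :
  cycle_pt c i.+1 = mesh_pt (vtx c (i %/ K)) (vtx c (i %/ K).+1) (i %% K).+1.
Proof.
rewrite /cycle_pt; have [h|h] := ltnP (i %% K).+1 K.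
  have -> : i.+1 = (i %/ K * K + (i %% K).+1)%N by rewrite addnS -divn_eq.
  by rewrite divnMDl // (divn_small h) addn0 modnMDl (modn_small h).
have hK : (i %% K).+1 = K by apply/eqP; rewrite eqn_leq h ltn_mod K_gt0.
have -> : i.+1 = ((i %/ K).+1 * K)%N by rewrite mulSn addnC -[X in (_ + X)%N]hK addnS -divn_eq.
by rewrite mulnK // modnMl hK mesh_pt0 mesh_ptK.
Qed.

Lemma cycle_pt_mesh c i : cycle_pt c i \in mesh.
Proof. by apply: mem_mesh; rewrite ltnW // ltn_mod. Qed.

Lemma cycle_pt_neq c i : is_cycle c -> cycle_pt c i != cycle_pt c i.+1.
Proof.
move=> cc; rewrite cycle_ptS; apply/eqP => /(edge_pt_inj (cycle_vtx_neq _ cc)).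
have kn : K%:R != 0 :> R by rewrite pnatr_eq0 -lt0n.
by move/(congr1 ( *%R^~ K%:R)); rewrite !mulfVK // => /eqP; rewrite eqr_nat eqn_leq ltnn andbF.
Qed.

Lemma cycle_pt_period c : cycle_pt c (size c * K) = cycle_pt c 0.
Proof.
rewrite /cycle_pt mulnK // modnMl mod0n div0n /vtx modnn mod0n.
by rewrite -[(size c).+1]addn1 modnDl.
Qed.

(** The form [.-1.+1] of the number of vertices matches the polygons indexed by a successor in the
    results above. *)
Definition mesh_polygon f c (i : 'I_(size c * K).-1.+1) : 'rV[R]_3 :=
  f (cycle_pt c i).

Arguments mesh_polygon : clear implicits.

Lemma mesh_polygon_size c : (0 < size c)%N -> (size c * K).-1.+1 = (size c * K)%N.
Proof. by move=> c0; rewrite prednK // muln_gt0 c0. Qed.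

Lemma mesh_polygonS f c i : (0 < size c)%N ->
  mesh_polygon f c (ordS i) = f (cycle_pt c i.+1).
Proof.
move=> c0; rewrite /mesh_polygon /=.
move: (ltn_ord i) (mesh_polygon_size c0); move: (nat_of_ord i) => {}i + e.
rewrite e.
rewrite leq_eqVlt => /orP[/eqP -> |h]; first by rewrite modnn cycle_pt_period.
by rewrite modn_small.
Qed.

Lemma mesh_polygon_sum f c (X : 'rV[R]_3 -> 'rV[R]_3 -> int) : is_cycle c ->
  \sum_i X (mesh_polygon f c i) (mesh_polygon f c (ordS i)) =
  cycle_sum c (fun u v =>
    \sum_(0 <= r < K) X (f (mesh_pt u v r)) (f (mesh_pt u v r.+1))).
Proof.
move=> /andP[uc sc]; have c0 : (0 < size c)%N by exact: ltn_trans sc.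
rewrite cycle_sumE //.
transitivity (\sum_(0 <= i < size c * K) X (f (cycle_pt c i)) (f (cycle_pt c i.+1))).
  rewrite -[in RHS](mesh_polygon_size c0) big_mkord; apply: eq_bigr => i _.
  by rewrite mesh_polygonS.
rewrite big_nat_mul; apply: eq_bigr => a _.
rewrite mulSn addnC -{1}[(a * K)%N]add0n big_addn addKn.
apply: eq_big_nat => r /andP[_ rK].
rewrite cycle_ptS /cycle_pt addnC modnMDl modn_small // divnMDl // divn_small //.
by rewrite addn0.
Qed.

(** One e is the oscillation of f over a subdivision step of length 1 / K, the other one the
    perturbation from f to f'. *)
Lemma mesh_polygon_approx f f' c (d e : R) : is_cycle c ->
  K%:R^-1 < d -> (forall u v s s', 0 <= s <= 1 -> 0 <= s' <= 1 ->
    `|s - s'| < d -> close e (f (edge_pt u v s)) (f (edge_pt u v s'))) ->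
  {in mesh, forall x, close e (f x) (f' x)} ->
  coord_approx (cycle_curve f c) (2 * e) (mesh_polygon f' c).
Proof.
move=> /andP[uc sc] Kd unif near i t.
have c0 : (0 < size c)%N by exact: ltn_trans sc.
move: (ltn_ord i) (mesh_polygon_size c0); rewrite /mesh_polygon.
move: (nat_of_ord i) => {}i + e1; rewrite e1 => ltiK.
have k0 : 0 < (size c)%:R :> R by rewrite ltr0n.
have K0 : 0 < K%:R :> R by rewrite ltr0n.
rewrite natrM ler_pdivrMr ?mulr_gt0 // ler_pdivlMr ?mulr_gt0 // => /andP[h1 h2].
have iK : (i %/ K < size c)%N.
  by rewrite ltn_divLR //; have := ltn_ord i; rewrite mesh_polygon_size.
pose s := t * (size c)%:R - (i %/ K)%:R.
have iE : i%:R = (i %/ K)%:R * K%:R + (i %% K)%:R :> R.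
  by rewrite -natrM -natrD -divn_eq.
have sK : s * K%:R = t * ((size c)%:R * K%:R) - (i %/ K)%:R * K%:R.
  by rewrite /s mulrBl mulrA.
have r1 : (i %% K)%:R <= s * K%:R by rewrite sK lerBrDl -iE.
have r2 : s * K%:R <= (i %% K)%:R + 1 by rewrite sK lerBlDl addrA -iE natr1.
have iK1 : (i %% K).+1%:R <= K%:R :> R by rewrite ler_nat ltn_mod.
have s01 : 0 <= s <= 1.
  rewrite -(ler_pM2r K0) mul0r -[s <= 1](ler_pM2r K0) mul1r.
  by rewrite (le_trans _ r1) //= (le_trans r2) // natr1.
have -> : t = ((i %/ K)%:R + s) / (size c)%:R.
  by rewrite /s addrC subrK mulfK // gt_eqF.
rewrite cycle_curve_edge //.
have [u0 u1 u2] := near _ (cycle_pt_mesh c i).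
have [|//|v0 v1 v2] := unif (vtx c (i %/ K)) (vtx c (i %/ K).+1) s ((i %% K)%:R / K%:R) s01.
  by apply: mesh_pt_itv; rewrite ltnW // ltn_mod.
  apply: le_lt_trans Kd; rewrite ger0_norm ?subr_ge0 ?ler_pdivrMr //.
  by rewrite lerBlDr -[X in X + _]mul1r -mulrDl ler_pdivlMr // addrC.
have tri (x y z : R) : `|x - y| < e -> `|y - z| < e -> `|x - z| < 2 * e.
  by rewrite !ltr_norml => /andP[? ?] /andP[? ?]; apply/andP; split; lra.
by split; [exact: tri u0 v0|exact: tri u1 v1|exact: tri u2 v2].
Qed.

End Cycles.

Arguments mesh_polygon {R m} x0 K f c.

(** * The linking form of two complete graphs *)

Section LinkingForm.
Context {R : realType} {m n : nat}.
Variables (G : 'rV[R]_m -> 'rV[R]_3) (H : 'rV[R]_n -> 'rV[R]_3).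
Hypotheses (contG : {within complete_graph R m, continuous G})
           (contH : {within complete_graph R n, continuous H}).
Variables (x0 : 'I_m) (y0 : 'I_n).

Definition generic_meshes K (G' : 'rV[R]_m -> 'rV[R]_3) (H' : 'rV[R]_n -> 'rV[R]_3) :=
  {in mesh K &, forall a b, a != b ->
     {in mesh K, forall z, orient (G' a) (G' b) (H' z) != 0}} /\
  {in mesh K &, forall a b, a != b ->
     {in mesh K, forall z, orient (H' a) (H' b) (G' z) != 0}}.

Lemma mesh_approximation (e : R) : 0 < e ->
  exists K (G' : 'rV[R]_m -> 'rV[R]_3) (H' : 'rV[R]_n -> 'rV[R]_3),
  [/\ (0 < K)%N,
      forall c, is_cycle c -> coord_approx (cycle_curve G c) e (mesh_polygon x0 K G' c),
      forall d, is_cycle d -> coord_approx (cycle_curve H d) e (mesh_polygon y0 K H' d) &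
      generic_meshes K G' H'].
Proof.
move=> e0; have e2 : 0 < e / 2 by rewrite divr_gt0.
have eE : e = 2 * (e / 2) by field.
have [d1 d10 hd1] := edge_unif_continuous contG e2.
have [d2 d20 hd2] := edge_unif_continuous contH e2.
pose d := Num.min d1 d2; have d0 : 0 < d by rewrite lt_min d10.
pose K := (Num.bound d^-1).+1.
have Kd : K%:R^-1 < d.
  rewrite -[d]invrK ltf_pV2 ?posrE ?invr_gt0 ?ltr0n //.
  apply: lt_trans (archi_boundP _) _; first by rewrite invr_ge0 ltW.
  by rewrite ltr_nat.
have [G' [H' [nG nH gGH gHG]]] := generic_maps G H (@mesh R m K) (@mesh R n K) e2.
exists K, G', H'; split=> //.
- move=> c cc; rewrite eE; apply: (@mesh_polygon_approx R m x0 K isT G G' c d _ cc Kd _ nG).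
  move=> u v s s' s01 s01' ss; apply: hd1 => //.
  by apply: lt_le_trans ss _; rewrite ge_min lexx.
- move=> c cc; rewrite eE; apply: (@mesh_polygon_approx R n y0 K isT H H' c d _ cc Kd _ nH).
  move=> u v s s' s01 s01' ss; apply: hd2 => //.
  by apply: lt_le_trans ss _; rewrite ge_min lexx orbT.
Qed.

Lemma mesh_general_position K G' H' c d : (0 < K)%N -> generic_meshes K G' H' ->
  is_cycle c -> is_cycle d ->
  general_position (mesh_polygon x0 K G' c) (mesh_polygon y0 K H' d).
Proof.
move=> K0 [gG gH] cc cd i j.
have [uc sc] := andP cc; have [ud sd] := andP cd.
rewrite !mesh_polygonS //; try by [exact: ltn_trans sc|exact: ltn_trans sd].
by split; [apply: gG|apply: gH]; rewrite ?cycle_pt_mesh ?cycle_pt_neq.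
Qed.

Hypothesis GH : disjoint_images G H.

(** A single perturbed mesh serves all pairs of cycles, so the crossing count splits into
    contributions of pairs of edges. Reversing an edge reverses its list of subdivision points,
    whence the antisymmetries; [polygon_lkC] lets the same form compute both orders of the
    curves. *)
Lemma linking_form : exists L : 'I_m -> 'I_m -> 'I_n -> 'I_n -> int,
  [/\ forall u v x y, L v u x y = - L u v x y,
      forall u v x y, L u v y x = - L u v x y,
      forall c d, is_cycle c -> is_cycle d ->
        Lk (cycle_curve G c) (cycle_curve H d) =
        cycle_sum c (fun u v => cycle_sum d (L u v)) &
      forall c d, is_cycle c -> is_cycle d ->
        Lk (cycle_curve H d) (cycle_curve G c) =
        cycle_sum c (fun u v => cycle_sum d (L u v))].
Proof.
have [r4 r40 gap] := embedding_gap contG contH GH.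
pose r := r4 / 4; have r0 : 0 < r by rewrite divr_gt0.
have r4E : 4 * r = r4 by rewrite /r; field.
have pos (k : nat) (c : seq 'I_k) : is_cycle c -> (0 < size c)%N.
  by move=> /andP[_ sc]; exact: ltn_trans sc.
have clG c : is_cycle c -> cycle_curve G c 0 = cycle_curve G c 1.
  by move=> cc; apply: cycle_curve_closed x0 _ _ (pos _ _ cc).
have clH d : is_cycle d -> cycle_curve H d 0 = cycle_curve H d 1.
  by move=> cd; apply: cycle_curve_closed y0 _ _ (pos _ _ cd).
have sep c d : is_cycle c -> is_cycle d ->
    separated (4 * r) (cycle_curve G c) (cycle_curve H d).
  move=> cc cd s t s01 t01; rewrite r4E.
  have [u [v [s' [hs ->]]]] := cycle_curve_range x0 G (pos _ _ cc) s01.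
  have [x [y [t' [ht ->]]]] := cycle_curve_range y0 H (pos _ _ cd) t01.
  exact: gap.
have sepC c d : is_cycle c -> is_cycle d ->
    separated (4 * r) (cycle_curve H d) (cycle_curve G c).
  by move=> cc cd s t s01 t01; apply: apartC; exact: sep.
have gpC M N (P : 'I_M -> 'rV[R]_3) (Q : 'I_N -> 'rV[R]_3) :
    general_position P Q -> general_position Q P.
  by move=> gp i j; have [? ?] := gp j i.
have [K [G' [H' [K0 aG aH gGH]]]] := mesh_approximation r0.
have fine c d (e : R) : is_cycle c -> is_cycle d -> 0 < e ->
    exists M N (P : 'I_M.+1 -> 'rV[R]_3) (Q : 'I_N.+1 -> 'rV[R]_3),
    [/\ coord_approx (cycle_curve G c) e P, coord_approx (cycle_curve H d) e Q &
        general_position P Q].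
  move=> cc cd e0; have [K' [G1 [H1 [K'0 aG1 aH1 gGH1]]]] := mesh_approximation e0.
  exists _, _, (mesh_polygon x0 K' G1 c), (mesh_polygon y0 K' H1 d).
  by split; [exact: aG1|exact: aH1|exact: mesh_general_position].
pose L u v x y := \sum_(0 <= k < K) \sum_(0 <= l < K)
  crossing (G' (mesh_pt K u v k)) (G' (mesh_pt K u v k.+1))
           (H' (mesh_pt K x y l)) (H' (mesh_pt K x y l.+1)).
have lkE c d : is_cycle c -> is_cycle d ->
    polygon_lk (mesh_polygon x0 K G' c) (mesh_polygon y0 K H' d) =
    cycle_sum c (fun u v => cycle_sum d (L u v)).
  move=> cc cd; rewrite [LHS](mesh_polygon_sum _ K0 _
    (edge_lk (mesh_polygon y0 K H' d)) cc).
  apply: eq_bigr => u _; rewrite /cycle_sum /L [RHS]exchange_big /=.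
  apply: eq_bigr => k _; exact: (mesh_polygon_sum _ K0 _ (crossing _ _) cd).
exists L; split.
- move=> u v x y; rewrite /L big_nat_rev /= -sumrN; apply: eq_big_nat => k /andP[_ kK].
  rewrite -sumrN; apply: eq_bigr => l _.
  rewrite add0n !(mesh_pt_sym K0 u v) ?leq_subr //; last by rewrite subnSK ?leq_subr.
  by rewrite subnSK // (subKn kK) (subKn (ltnW kK)) crossingC.
- move=> u v x y; rewrite /L -sumrN; apply: eq_bigr => k _.
  rewrite big_nat_rev /= -sumrN; apply: eq_big_nat => l /andP[_ lK].
  rewrite add0n !(mesh_pt_sym K0 x y) ?leq_subr //; last by rewrite subnSK ?leq_subr.
  by rewrite subnSK // (subKn lK) (subKn (ltnW lK)) crossingCr.
- move=> c d cc cd; rewrite -lkE //; apply: (Lk_polygon r0) => //.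
  + exact: clG.
  + exact: clH.
  + exact: sep.
  + by move=> e e0; exact: fine.
  + exact: aG.
  + exact: aH.
  + exact: mesh_general_position.
- move=> c d cc cd; have gp := mesh_general_position K0 gGH cc cd.
  rewrite -lkE // -(@polygon_lkC _ r) //.
  + apply: (Lk_polygon r0) => //; [exact: clH|exact: clG|exact: sepC| |exact: aH|exact: aG|].
      move=> e e0; have [M [N [P [Q [aP aQ gPQ]]]]] := fine c d e cc cd e0.
      by exists N, M, Q, P; split=> //; exact: gpC.
    exact: gpC.
  + move=> i; have [t [t01 h1 h2]] := capprox_anchor (clG _ cc) i (aG _ cc).
    exists (cycle_curve G c t); split=> //.
    apply: (far_from_approx (clH _ cd) _ (aH _ cd)) t01 => s t' s01 t01'.
    by case: (sep _ _ cc cd s t' s01 t01') => h;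
      [apply: Or31|apply: Or32|apply: Or33]; apply: le_trans h; lra.
  + by move=> i j; have [_] := gp i j.
  (* Two indices may denote the same point; this is the degenerate case that [avoids] admits. *)
  + move=> i i' j; have [e|ne] := eqVneq (cycle_pt x0 K c i : 'rV[R]_m) (cycle_pt x0 K c i').
      by left; rewrite /mesh_polygon e.
    by right; apply: (proj1 gGH); rewrite ?cycle_pt_mesh.
Qed.

End LinkingForm.

(** * Cycle sums of a form whose nonzero triangles share a vertex *)

Section CycleSums.
Variable V : eqType.
Implicit Types (F : V -> V -> int) (c : seq V).

(** [next c] permutes the vertices of c, with inverse [prev c]. *)
Lemma cycle_sum_next_telescope c (phi : V -> int) : uniq c ->
  \sum_(x <- c) (phi (next c x) - phi x) = 0.
Proof.
move=> uc; rewrite sumrB; apply/eqP; rewrite subr_eq0; apply/eqP.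
rewrite -(big_map (next c) xpredT phi); apply: perm_big.
apply: uniq_perm => //.
  rewrite map_inj_in_uniq // => x y _ _ /(congr1 (prev c)).
  by rewrite !prev_next.
move=> x; apply/mapP/idP => [[y yc ->]|xc]; first by rewrite mem_next.
by exists (prev c x); rewrite ?mem_prev ?next_prev.
Qed.

End CycleSums.

Section Pencil.
Variable m : nat.
Implicit Types (F : 'I_m -> 'I_m -> int) (u v w x y : 'I_m) (c : seq 'I_m).

Definition tri F u v w : int := F u v + F v w + F w u.

Lemma cycle_sum_tri F u v w : uniq [:: u; v; w] ->
  cycle_sum [:: u; v; w] F = tri F u v w.
Proof.
rewrite /= !inE negb_or => /andP[/andP[uv uw] /andP[vw _]].
rewrite /cycle_sum !big_cons big_nil /= !eqxx.
rewrite (eq_sym v u) (eq_sym w u) (eq_sym w v).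
by rewrite (negbTE uv) (negbTE uw) (negbTE vw) /tri addr0 addrA.
Qed.

Lemma cycle_sum_rot F c k : uniq c -> cycle_sum (rot k c) F = cycle_sum c F.
Proof.
move=> uc; rewrite /cycle_sum (perm_big c) ?perm_rot //=.
by apply: eq_bigr => x _; rewrite next_rot.
Qed.

Definition antisymmetric_form F := forall u v, F v u = - F u v.

(** The algebraic form of the hypothesis that all linking triangles pass through p. *)
Definition pencil p F := forall u v w, uniq [:: u; v; w] -> p \notin [:: u; v; w] ->
  tri F u v w = 0.

Lemma form_refl F u : antisymmetric_form F -> F u u = 0.
Proof. by move=> aF; have := aF u u; lia. Qed.

Lemma pencil_tri p F u v w : antisymmetric_form F -> pencil p F ->
  u != p -> v != p -> w != p -> tri F u v w = 0.
Proof.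
move=> aF pF up vp wp.
have [->|uv] := eqVneq u v.
  by have := aF v w; have := form_refl v aF; rewrite /tri; lia.
have [->|uw] := eqVneq u w.
  by have := aF v w; have := form_refl w aF; rewrite /tri; lia.
have [->|vw] := eqVneq v w.
  by have := aF u w; have := form_refl w aF; rewrite /tri; lia.
apply: pF; first by rewrite /= !inE negb_or uv uw vw.
by rewrite !inE !negb_or !(eq_sym p) up vp wp.
Qed.

(** The faces of the tetrahedron p, u, v, w have signed sum 0, and the face without p vanishes. Thus
    [tri F p w] is a potential for the triangles at p. *)
Lemma tri_pencilB p F u v w : antisymmetric_form F -> pencil p F ->
  u != p -> v != p -> w != p -> tri F p u v = tri F p w v - tri F p w u.
Proof.
move=> aF pF up vp wp; have := pencil_tri aF pF wp up vp.
have := aF p u; have := aF p v; have := aF p w; have := aF w v.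
by rewrite /tri; lia.
Qed.

Lemma cycle_prev_next p c : is_cycle c -> p \in c ->
  uniq [:: p; next c p; prev c p].
Proof.
move=> /andP[uc sc] pc; have c0 : (0 < size c)%N by exact: ltn_trans sc.
(* The index of the predecessor of p modulo the length; p and its successor are then at a + 1 and a
   + 2. *)
pose a := (index p c + (size c).-1)%N.
have pE : p = vtx p c a.+1.
  by rewrite /vtx /a -addnS prednK // modnDr modn_small ?index_mem // nth_index.
have := next_vtx p a.+1 uc c0; rewrite -pE => ->.
have := next_vtx p a uc c0; rewrite -pE => e.
have -> : prev c p = vtx p c a by rewrite -[RHS](prev_next uc) e.
rewrite [X in uniq (X :: _)]pE /= !inE !andbT negb_or /vtx !nth_uniq ?ltn_mod //.
have D i j : (i < 3)%N -> (j < 3)%N ->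
    (a + i == a + j %[mod size c]) = (i == j).
  by move=> i3 j3; rewrite eqn_modDl !modn_small // (leq_trans _ sc).
have := D 1 2 isT isT; have := D 1 0 isT isT; have := D 2 0 isT isT.
by rewrite addn0 addn1 addn2 => -> -> ->.
Qed.

Lemma cycle_sum_gauge p F c : antisymmetric_form F -> uniq c ->
  cycle_sum c F = \sum_(x <- c) tri F p x (next c x).
Proof.
move=> aF uc; rewrite -[LHS]addr0 -[X in _ + X = _](cycle_sum_next_telescope (fun x => - F p x) uc).
rewrite /cycle_sum -big_split /=; apply: eq_bigr => x _.
by have := aF p (next c x); rewrite /tri; lia.
Qed.

(** In the cone over p, every triangle whose base avoids p is a difference of potentials. A cycle
    through p therefore counts like the triangle of p and its two neighbours, and any other cycle
    counts 0. *)
Lemma cycle_sum_pencil p F c : antisymmetric_form F -> pencil p F -> is_cycle c ->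
  cycle_sum c F = if p \in c then tri F p (next c p) (prev c p) else 0.
Proof.
move=> aF pF cc; have [uc sc] := andP cc.
rewrite (cycle_sum_gauge p aF uc); have [pc|pc] := boolP (p \in c); last first.
  case: c {cc} uc sc pc => // w c' uc sc pc.
  have np x : x \in w :: c' -> x != p by apply: contraTneq => ->.
  rewrite -[RHS](cycle_sum_next_telescope (tri F p w) uc).
  apply: eq_big_seq => x xc; apply: (tri_pencilB aF pF); apply: np => //.
    by rewrite mem_next.
  exact: mem_head.
have /= := cycle_prev_next cc pc.
rewrite !inE negb_or andbT => /andP[/andP[pn pp] np].
have F0 := form_refl p aF.
set w := next c p in pn np *; set z := prev c p in pp np *.
have zc : z \in c by rewrite mem_prev.
have wp : w != p by rewrite eq_sym. have zp : z != p by rewrite eq_sym.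
(* Subtracting the telescoping sum of the potential [tri F p w] leaves only the term at the
   predecessor z of p. *)
apply/eqP; rewrite -[X in X == _]subr0 -[X in _ - X == _](cycle_sum_next_telescope (tri F p w) uc).
rewrite -sumrB (bigD1_seq p) //= big_mkcond /= (bigD1_seq z) //= zp.
rewrite [in next c z]/z next_prev // -/w.
rewrite big_seq_cond big1 ?addr0; last first.
  move=> x /andP[xc xz]; case: ifP => // xp.
  rewrite (tri_pencilB aF pF _ _ wp) ?xp ?subrr //.
  apply: contra_neq xz => e; rewrite /z -e prev_next //.
apply/eqP; rewrite /tri F0.
by have := form_refl w aF; have := aF p w; have := aF p z; lia.
Qed.

End Pencil.

Local Close Scope classical_set_scope.

(** * Matrices with small minors are staircases *)

Section Staircase.
Variables (V W : finType) (D : {set V}) (E : {set W}) (A : V -> W -> int).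
Variables (a0 : V) (u0 : W).
Hypotheses (a0D : a0 \in D) (u0E : u0 \in E) (row0 : forall u, A a0 u = 0).
Hypothesis minors : forall a b u v, a \in D -> b \in D -> u \in E -> v \in E ->
  `|A b v - A a v - A b u + A a u| <= 1.

Definition lower_set a : {set W} := [set u in E | [exists v in E, A a u < A a v]].

(** The minors with the zero row [a0] bound the variation of a row by 1: it equals its maximum off
    its lower set and one less on it. *)
Lemma lower_setP a : a \in D -> exists2 u, u \in E & forall v, v \in E ->
  A a v = A a u - (v \in lower_set a)%:Z.
Proof.
move=> aD; have [u uE umax] := @Order.TotalTheory.arg_maxP _ _ _ u0 (mem E) (A a) u0E.
exists u => // v vE; rewrite inE vE /=.
have := minors a0D aD vE uE; rewrite !row0 subr0 addr0 => bnd.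
have vu : A a v <= A a u := umax v vE.
have [/exists_inP[w wE vw]|/exists_inPn h] := boolP [exists w in E, A a v < A a w].
  by have : A a w <= A a u := umax w wE; lia.
by have := h u uE; lia.
Qed.

(** Columns showing that neither set contains the other would give a minor equal to -2. *)
Lemma lower_set_chain a b : a \in D -> b \in D ->
  (lower_set a \subset lower_set b) || (lower_set b \subset lower_set a).
Proof.
move=> aD bD; have [x xE hx] := lower_setP aD; have [y yE hy] := lower_setP bD.
apply: contraT; rewrite negb_or => /andP[/subsetPn[u ua ub] /subsetPn[v vb va]].
have uE : u \in E by move: ua; rewrite inE => /andP[].
have vE : v \in E by move: vb; rewrite inE => /andP[].
have := minors aD bD uE vE.
rewrite (hx u) // (hx v) // (hy u) // (hy v) // ua vb (negbTE ub) (negbTE va).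
have e (s t : int) : t - 1 - (s - 0) - (t - 0) + (s - 1) = - 2 by ring.
by rewrite [X in `|X| <= 1](e (A a x) (A b y)).
Qed.

Definition lower_sets := [set lower_set a | a in D].

Definition row_rank a := #|[set X in lower_sets | X \proper lower_set a]|.

(** The sets missing u are an initial segment of the chain, and this is the position of the last
    one, counted from 0; the predecessor accounts for the empty set, which always misses u. *)
Definition col_rank (u : W) := #|[set X in lower_sets | u \notin X]|.-1.

Lemma lower_sets_chain X Y : X \in lower_sets -> Y \in lower_sets ->
  (X \subset Y) || (Y \subset X).
Proof. by move=> /imsetP[a aD ->] /imsetP[b bD ->]; exact: lower_set_chain. Qed.

Lemma lower_set0 : lower_set a0 = finset.set0.
Proof.
apply/setP => u; rewrite !inE; apply/negbTE; rewrite negb_and orbC.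
by apply/orP; left; apply/exists_inPn => v _; rewrite !row0 ltxx.
Qed.

Lemma lower_sets0 : finset.set0 \in lower_sets.
Proof. by rewrite -lower_set0 imset_f. Qed.

Lemma col_rankS u : (col_rank u).+1 = #|[set X in lower_sets | u \notin X]|.
Proof.
by rewrite prednK // card_gt0; apply/set0Pn; exists finset.set0; rewrite !inE lower_sets0.
Qed.

(** A column u belongs to a set of the chain exactly when all the sets missing u come strictly
    before it. *)
Lemma rank_lt a u : a \in D -> (col_rank u < row_rank a)%N = (u \in lower_set a).
Proof.
move=> aD; have aS : lower_set a \in lower_sets by exact: imset_f.
rewrite col_rankS; have [ua|ua] := boolP (u \in lower_set a).
  apply: subset_leq_card; apply/fintype.subsetP => X; rewrite !inE => /andP[XS uX].
  rewrite XS properE; case/orP: (lower_sets_chain XS aS) => h.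
    rewrite h /=; apply: contra uX => /fintype.subsetP; exact.
  by case/negP: uX; move/fintype.subsetP: h; exact.
apply/negbTE; rewrite -ltnNge; apply: proper_card; apply/properP; split.
  apply/fintype.subsetP => X; rewrite !inE => /andP[-> Xa] /=.
  by apply: contra ua; move/proper_sub/fintype.subsetP: Xa; exact.
exists (lower_set a); first by rewrite inE aS ua.
by rewrite inE fintype.properxx andbF.
Qed.

Lemma row_rank_lt a : a \in D -> (row_rank a < #|lower_sets|)%N.
Proof.
move=> aD; apply: proper_card; apply/properP; split.
  by apply/fintype.subsetP => X; rewrite !inE => /andP[].
by exists (lower_set a); rewrite ?imset_f // inE fintype.properxx andbF.
Qed.

Lemma col_rank_lt u : (col_rank u < #|lower_sets|)%N.
Proof.
rewrite col_rankS; apply: subset_leq_card.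
by apply/fintype.subsetP => X; rewrite !inE => /andP[].
Qed.

(** Counting proper predecessors is injective on a chain, and its values lie among as many integers
    as there are sets. *)
Lemma row_rank_surj i : (i < #|lower_sets|)%N -> exists2 a, a \in D & row_rank a = i.
Proof.
move=> il; pose h (X : {set W}) := #|[set Y in lower_sets | Y \proper X]|.
have h_inj : {in lower_sets &, injective h}.
  have lt (X Y : {set W}) : X \in lower_sets -> X \proper Y -> (h X < h Y)%N.
    move=> XS XY; apply: proper_card; apply/properP; split.
      apply/fintype.subsetP => Z; rewrite !inE => /andP[-> ZX].
      exact: proper_trans ZX XY.
    by exists X; rewrite !inE XS ?XY // fintype.properxx.
  move=> X Y XS YS e; apply/eqP; rewrite finset.eqEsubset; apply/andP.
  by case/orP: (lower_sets_chain XS YS) => XY; split=> //; apply: contraT => YX;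
    [have := lt X Y XS|have := lt Y X YS]; rewrite properE XY YX e ltnn => /(_ isT).
have : i \in map h (enum lower_sets).
  have [||| _ ->] := @uniq_min_size _ (map h (enum lower_sets)) (iota 0 #|lower_sets|).
  - by rewrite map_inj_in_uniq ?enum_uniq // => X Y; rewrite !mem_enum; exact: h_inj.
  - move=> j /mapP[X]; rewrite mem_enum => /imsetP[a aD ->] ->.
    by rewrite mem_iota add0n row_rank_lt.
  - by rewrite size_iota size_map cardE.
  - by rewrite mem_iota.
move=> /mapP[X]; rewrite mem_enum => /imsetP[a aD ->] ->.
by exists a.
Qed.

Lemma col_rank_surj i : (i < #|lower_sets|)%N -> exists2 u, u \in E & col_rank u = i.
Proof.
move=> il; have [b bD bi] := row_rank_surj il.
have [i1|] := ltnP i.+1 #|lower_sets|.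
  have [a aD ai] := row_rank_surj i1.
  (* A column added between the i-th and the next set has rank i. *)
  have /subsetPn[u ua ub] : ~~ (lower_set a \subset lower_set b).
    apply/negP => ab; suff : (row_rank a <= row_rank b)%N by rewrite ai bi ltnn.
    apply: subset_leq_card; apply/fintype.subsetP => X; rewrite !inE => /andP[-> Xa] /=.
    exact: proper_sub_trans Xa ab.
  exists u; first by move: ua; rewrite inE => /andP[].
  move: ua ub; rewrite -!rank_lt // ai bi -leqNgt ltnS => h1 h2.
  by apply/eqP; rewrite eqn_leq h1 h2.
(* For the last index, a column where row b is maximal is outside the largest set, so it has the top
   rank. *)
move=> li; have [u uE hu] := lower_setP bD; exists u => //.
have : u \notin lower_set b by apply/negP => ub; have := hu u uE; rewrite ub; lia.
rewrite -rank_lt // bi -leqNgt => h; apply/eqP; rewrite eqn_leq h andbT.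
by rewrite -ltnS (leq_trans (col_rank_lt u)).
Qed.

Lemma staircase : exists (l : nat) (r : V -> nat) (rho : W -> nat),
  [/\ [/\ (0 < l)%N, forall a, a \in D -> (r a < l)%N & forall u, u \in E -> (rho u < l)%N],
      forall i, (i < l)%N -> exists2 a, a \in D & r a = i,
      forall i, (i < l)%N -> exists2 u, u \in E & rho u = i &
      forall a b u v, a \in D -> b \in D -> u \in E -> v \in E ->
        A b v - A a v - A b u + A a u =
        (rho v < r a)%N%:Z - (rho v < r b)%N%:Z + (rho u < r b)%N%:Z - (rho u < r a)%N%:Z].
Proof.
exists #|lower_sets|, row_rank, col_rank; split.
- split; [|exact: row_rank_lt|by move=> u _; exact: col_rank_lt].
  by apply/card_gt0P; exists finset.set0; exact: lower_sets0.
- exact: row_rank_surj.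
- exact: col_rank_surj.
- move=> a b u v aD bD uE vE; rewrite !rank_lt //.
  have [x _ hx] := lower_setP aD; have [y _ hy] := lower_setP bD.
  by rewrite (hx u) // (hx v) // (hy u) // (hy v) //; ring.
Qed.

End Staircase.

(** * Partitions into the classes of a rank function *)

Section RankPartition.
Variables (V : finType) (D : {set V}) (l : nat) (r : V -> nat).
Hypotheses (r_lt : forall a, a \in D -> (r a < l)%N)
           (r_surj : forall i, (i < l)%N -> exists2 a, a \in D & r a = i).

Definition rank_class (i : 'I_l) : {set V} := [set a in D | r a == i].

Lemma rank_classP (i : 'I_l) a : reflect (a \in D /\ r a = i) (a \in rank_class i).
Proof. by rewrite inE; apply: (iffP andP) => -[? /eqP]. Qed.

Lemma rank_class_partition : labelled_partition rank_class D.
Proof.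
have ne i : exists2 a, a \in rank_class i & r a = i.
  have [a aD ai] := r_surj (ltn_ord i).
  by exists a => //; apply/rank_classP.
split.
  move=> i j e; have [a ai rai] := ne i.
  by move: ai; rewrite e => /rank_classP[_ rj]; apply: val_inj; rewrite /= -rai -rj.
apply/and3P; split.
- rewrite /cover; apply/eqP/setP => a; apply/bigcupP/idP => [[_ /imsetP[i _ ->]]|aD].
    by case/rank_classP.
  exists (rank_class (Ordinal (r_lt aD))); first exact: imset_f.
  by apply/rank_classP.
- apply/finset.trivIsetP => _ _ /imsetP[i _ ->] /imsetP[j _ ->] ij.
  rewrite -finset.setI_eq0; apply: contraNT ij => /set0Pn[a].
  rewrite inE => /andP[/rank_classP[_ ei] /rank_classP[_ ej]].
  by rewrite (_ : i = j) //; apply: val_inj; rewrite /= -ei -ej.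
- by apply/negP => /imsetP[i _ e]; have [a] := ne i; rewrite -e inE.
Qed.

Lemma card_rank_classes : (l <= #|D|)%N.
Proof.
rewrite -(size_iota 0 l) cardE -(size_map r); apply: uniq_leq_size.
  exact: iota_uniq.
move=> i; rewrite mem_iota add0n => il; have [a aD <-] := r_surj il.
by rewrite map_f // mem_enum.
Qed.

Lemma bigcup_rank_class (P : pred nat) :
  (\bigcup_(i < l | P i) rank_class i)%SET = [set a in D | P (r a)].
Proof.
apply/setP => a; rewrite inE; apply/bigcupP/andP => [[i Pi /rank_classP[aD e]]|[aD Pa]].
  by rewrite aD e.
by exists (Ordinal (r_lt aD)) => //; apply/rank_classP.
Qed.

End RankPartition.

(** * Stars *)

(** On triangles at q the form is a difference of indicators of O: 1 from O to its complement, -1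
    backwards, 0 otherwise. [u0] and [v0] show that both parts of the star are nonempty. *)
Lemma star_of_form (R : realType) (n : nat) (C : R -> 'rV[R]_3)
    (g : 'rV[R]_n -> 'rV[R]_3) (q : 'I_n) (O : {set 'I_n}) (F : 'I_n -> 'I_n -> int)
    (u0 v0 : 'I_n) :
  antisymmetric_form F -> pencil q F ->
  (forall d, is_cycle d -> Lk C (cycle_curve g d) = cycle_sum d F) ->
  (forall u v, u != q -> v != q -> tri F q u v = (u \in O)%:Z - (v \in O)%:Z) ->
  q \notin O -> u0 \in O -> v0 != q -> v0 \notin O ->
  links_in_star C g q O ((~: [set q]) :\: O)%SET.
Proof.
move=> aF pF lkE triE qO u0O v0q v0O; set I := (_ :\: _)%SET.
have inI v : (v \in I) = (v \notin O) && (v != q) by rewrite !inE.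
have u0q : u0 != q by apply: contraTneq u0O => ->.
split.
  pose r a := if a == q then 0%N else if a \in O then 1%N else 2%N.
  have -> : tnth [tuple [set q]%SET; O; I] = @rank_class _ [set: 'I_n]%SET 3 r.
    apply/funext => -[[|[|[|//]]] hi]; apply/setP => a;
      rewrite /tnth /= ?inI !inE /r; have [e|aq] := eqVneq a q;
      rewrite ?e ?(negbTE qO) //=; case: (a \in O) => //.
  apply: rank_class_partition => [a _|i].
    by rewrite /r; case: ifP => // _; case: ifP.
  case: i => [|[|[|//]]] _.
  - by exists q; rewrite ?inE // /r eqxx.
  - by exists u0; rewrite ?inE // /r (negbTE u0q) u0O.
  - by exists v0; rewrite ?inE // /r (negbTE v0q) (negbTE v0O).
move=> a b c uT T.
have cyc_tri x y z : uniq [:: x; y; z] -> is_cycle [:: x; y; z] by move=> h; rewrite /is_cycle h.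
have star_sum S : uniq S -> in_star q O I S -> cycle_sum S F = 1.
  move=> uS [u [v [uO vI [k eS]]]]; move: uS; rewrite eS rot_uniq => uS.
  rewrite cycle_sum_rot // cycle_sum_tri // triE //.
  - by rewrite uO; move: vI; rewrite inI => /andP[/negbTE -> _].
  - by apply: contraTneq uO => ->.
  - by move: vI; rewrite inI => /andP[].
have revE : cycle_sum (rev T) F = - cycle_sum T F.
  rewrite /T /rev /= !cycle_sum_tri //; last by rewrite -rev_uniq.
  have := aF a b; have := aF b c; have := aF c a.
  by rewrite /tri; lia.
rewrite lkE ?cyc_tri //; split.
- exact: star_sum.
- by move/star_sum; rewrite revE rev_uniq => /(_ uT); lia.
- have [qT|qT] := boolP (q \in T); last first.
    by move=> _ _; rewrite cycle_sum_tri //; apply: pF.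
  (* Rotate both orientations of the triangle so that q comes first. *)
  have [k [k' [u [v [eT eT']]]]] : exists k k' u v,
      T = rot k [:: q; u; v] /\ rev T = rot k' [:: q; v; u].
    move: qT; rewrite /T !inE => /or3P[] /eqP ->.
    - by exists 0%N, 1%N, b, c.
    - by exists 2%N, 2%N, c, a.
    - by exists 1%N, 0%N, a, b.
  have uq : uniq [:: q; u; v] by rewrite -(rot_uniq k) -eT.
  move: (uq); rewrite /= !inE negb_or => /andP[/andP[qu qv] _].
  rewrite eq_sym in qu; rewrite eq_sym in qv.
  have [uO|uO] := boolP (u \in O); have [vO|vO] := boolP (v \in O) => n1 n2.
  + by rewrite eT cycle_sum_rot // cycle_sum_tri // triE // uO vO subrr.
  + by case: n1; exists u, v; split; rewrite ?inI ?vO //; exists k.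
  + by case: n2; exists v, u; split; rewrite ?inI ?uO //; exists k'.
  + by rewrite eT cycle_sum_rot // cycle_sum_tri // triE // (negbTE uO) (negbTE vO) subrr.
Qed.

(** * Arithmetic of ranks and indicators *)

Lemma leq_minn_pred l m n : (l <= m.-1)%N -> (l <= n.-1)%N -> (l <= (minn m n).-1)%N.
Proof. by rewrite /minn; case: ifP. Qed.

(** A column whose rank is the smaller of two distinct row ranks lies in exactly one of the two
    lower sets. *)
Lemma minn_jump (a b : nat) :
  a != b -> (minn a b < b)%N%:Z - (minn a b < a)%N%:Z <> 0.
Proof.
rewrite neq_ltn => /orP[] h.
  by rewrite (minn_idPl (ltnW h)) h ltnn.
by rewrite (minn_idPr (ltnW h)) h ltnn.
Qed.

(** A row whose rank is the larger of two distinct column ranks has exactly one of the two columns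
    in its lower set. *)
Lemma maxn_jump (a b : nat) :
  a != b -> (a < maxn a b)%N%:Z - (b < maxn a b)%N%:Z <> 0.
Proof.
rewrite neq_ltn => /orP[] h.
  by rewrite (maxn_idPr (ltnW h)) h ltnn.
by rewrite (maxn_idPl (ltnW h)) h ltnn.
Qed.

Lemma itv_indicator (i j k : nat) : (j <= k)%N ->
  (j <= i < k)%N%:Z = (i < k)%N%:Z - (i < j)%N%:Z.
Proof.
move=> jk; have [ij|ji] := ltnP i j => /=; last by rewrite subr0.
by rewrite (leq_trans ij jk).
Qed.

Lemma itv_indicatorN (i j k : nat) : (j <= k)%N ->
  (~~ (j < i < k.+1)%N)%:Z = (k < i)%N%:Z + 1 - (j < i)%N%:Z.
Proof.
move=> jk; have [ji|ij] := ltnP j i => /=.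
  by rewrite -leqNgt addrK.
by rewrite subr0 ltnNge (leq_trans ij jk).
Qed.

Lemma four_terms (a b c d : int) : a - b + c - d = (c - d) - (b - a).
Proof. by ring. Qed.

Lemma four_termsN (a b c d : int) : a - b + c - d = (a + 1 - d) - (b + 1 - c).
Proof. by ring. Qed.

(** * From the linking form to the partitions and stars *)

Theorem theorem6p4 (R : realType) (m n : nat) (hm : (5 <= m)%N) (hn : (5 <= n)%N)
  (G : 'rV[R]_m -> 'rV[R]_3) (H : 'rV[R]_n -> 'rV[R]_3)
  (hG : graph_embedding G) (hH : graph_embedding H)
  (hGH : disjoint_images G H) (hw : weakly_linked G H)
  (p : 'I_m) (q : 'I_n)
  (hp : forall a b c : 'I_m, uniq [:: a; b; c] ->
     links_graph (cycle_curve G [:: a; b; c]) H -> p \in [:: a; b; c])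
  (hq : forall a b c : 'I_n, uniq [:: a; b; c] ->
     links_graph (cycle_curve H [:: a; b; c]) G -> q \in [:: a; b; c]) :
  exists l : nat, (2 <= l <= (minn m n).-1)%N /\
  exists (X : 'I_l -> {set 'I_m}) (Y : 'I_l -> {set 'I_n}),
  [/\ labelled_partition X (~: [set p])%SET /\
      (forall (i j : 'I_l) (x y : 'I_m), x \in X i -> y \in X j -> x <> y ->
         links_graph (cycle_curve G [:: p; x; y]) H <-> i <> j),
      labelled_partition Y (~: [set q])%SET /\
      (forall (i j : 'I_l) (u v : 'I_n), u \in Y i -> v \in Y j -> u <> v ->
         links_graph (cycle_curve H [:: q; u; v]) G <-> i <> j),
      forall j k : 'I_l, (j < k)%N ->
        let Ojk := (\bigcup_(i < l | (j <= i < k)%N) Y i)%SET in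
        let Ijk := ((\bigcup_(i < l | (i < j)%N) Y i) :|:
                  (\bigcup_(i < l | (k <= i)%N) Y i))%SET in
        Ijk = ((~: [set q]) :\: Ojk)%SET /\
        forall xj xk : 'I_m, xj \in X j -> xk \in X k ->
          links_in_star (cycle_curve G [:: p; xj; xk]) H q Ojk Ijk
    & forall j k : 'I_l, (j < k)%N ->
        let Jjk := (\bigcup_(i < l | (j < i <= k)%N) X i)%SET in
        let Pjk := ((\bigcup_(i < l | (i <= j)%N) X i) :|:
                  (\bigcup_(i < l | (k < i)%N) X i))%SET in
        Pjk = ((~: [set p]) :\: Jjk)%SET /\
        forall yj yk : 'I_n, yj \in Y j -> yk \in Y k ->
          links_in_star (cycle_curve H [:: q; yj; yk]) G p Pjk Jjk].
Proof.
have [L [L1 L2 lkG lkH]] := linking_form hG.1 hH.1 p q hGH.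
pose Fd d : 'I_m -> 'I_m -> int := fun u v => cycle_sum d (L u v).
pose Fc c : 'I_n -> 'I_n -> int := fun x y => cycle_sum c (fun u v => L u v x y).
have swap c d : cycle_sum c (Fd d) = cycle_sum d (Fc c).
  by rewrite /cycle_sum exchange_big.
have aFd d : antisymmetric_form (Fd d).
  by move=> u v; rewrite /Fd /cycle_sum -sumrN; apply: eq_bigr => x _.
have aFc c : antisymmetric_form (Fc c).
  by move=> u v; rewrite /Fc /cycle_sum -sumrN; apply: eq_bigr => x _.
have cyc k (x y z : 'I_k) : uniq [:: x; y; z] -> is_cycle [:: x; y; z].
  by move=> h; rewrite /is_cycle h.
have pFd d : is_cycle d -> pencil p (Fd d).
  move=> cd a b c uT pT; rewrite -cycle_sum_tri //.
  apply/eqP/negPn/negP => /eqP ne; case/negP: pT; apply: hp => //.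
  by exists d => //; rewrite /linked lkG ?cyc.
have pFc c : is_cycle c -> pencil q (Fc c).
  move=> cc u v w uT qT; rewrite -cycle_sum_tri // -swap.
  apply/eqP/negPn/negP => /eqP ne; case/negP: qT; apply: hq => //.
  by exists c => //; rewrite /linked lkH ?cyc.
(* The linking number of the triangles pab and quv, written in terms of [L] so that it also makes
   sense, and vanishes, when a = b or u = v. *)
pose lam a b u v := tri (fun x y => tri (L x y) q u v) p a b.
have lamFd a b u v : uniq [:: q; u; v] -> lam a b u v = tri (Fd [:: q; u; v]) p a b.
  by move=> uT; rewrite /lam /tri /Fd !cycle_sum_tri.
have lamFc a b u v : uniq [:: p; a; b] -> lam a b u v = tri (Fc [:: p; a; b]) q u v.
  by move=> uT; rewrite /lam [RHS]/tri /Fc !cycle_sum_tri // /tri; ring.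
have lam_refll a u v : lam a a u v = 0.
  rewrite /lam /tri; have := (L1 p a, L1 a a); move=> [e1 e2].
  have := (e1 q u, e1 u v, e1 v q); have := (e2 q u, e2 u v, e2 v q).
  by move=> [[? ?] ?] [[? ?] ?]; lia.
have lam_reflr a b u : lam a b u u = 0.
  rewrite /lam /tri.
  have e x y : L x y q u + L x y u u + L x y u q = 0.
    by have := L2 x y u u; have := L2 x y q u; lia.
  by rewrite !e.
have utri k (x y z : 'I_k) : y != x -> z != x -> y != z -> uniq [:: x; y; z].
  by move=> yx zx yz; rewrite /= !inE negb_or !(eq_sym x) yx zx yz.
have lamBl a b c u v : a != p -> b != p -> c != p -> u != q -> v != q ->
    lam a b u v = lam c b u v - lam c a u v.
  move=> ap bp cp uq vq; have [->|uv] := eqVneq u v; first by rewrite !lam_reflr subrr.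
  have uT := utri _ _ _ _ uq vq uv; rewrite !lamFd //.
  exact: tri_pencilB (aFd _) (pFd _ (cyc _ _ _ _ uT)) ap bp cp.
have lamBr a b u v w : a != p -> b != p -> u != q -> v != q -> w != q ->
    lam a b u v = lam a b w v - lam a b w u.
  move=> ap bp uq vq wq; have [->|ab] := eqVneq a b; first by rewrite !lam_refll subrr.
  have uT := utri _ _ _ _ ap bp ab; rewrite !lamFc //.
  exact: tri_pencilB (aFc _) (pFc _ (cyc _ _ _ _ uT)) uq vq wq.
have lamLk a b u v : uniq [:: p; a; b] -> uniq [:: q; u; v] ->
    lam a b u v = Lk (cycle_curve G [:: p; a; b]) (cycle_curve H [:: q; u; v]).
  by move=> h1 h2; rewrite lkG ?cyc // cycle_sum_tri // lamFd.
have lam_le1 a b u v : a != p -> b != p -> u != q -> v != q -> `|lam a b u v| <= 1.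
  move=> ap bp uq vq.
  have [->|ab] := eqVneq a b; first by rewrite lam_refll normr0.
  have [->|uv] := eqVneq u v; first by rewrite lam_reflr normr0.
  have h1 := utri _ _ _ _ ap bp ab; have h2 := utri _ _ _ _ uq vq uv.
  rewrite lamLk // -ltzD1 ltNge; apply/negP.
  exact: hw.2 _ _ (cyc _ _ _ _ h1) (cyc _ _ _ _ h2).
(* If pab links some cycle d, it links the triangle formed by q and its neighbours in d. *)
have lam_linked a b d : uniq [:: p; a; b] -> is_cycle d ->
    cycle_sum d (Fc [:: p; a; b]) <> 0 ->
    exists u v, uniq [:: q; u; v] /\ lam a b u v <> 0.
  move=> uT cd; rewrite (cycle_sum_pencil (aFc _) (pFc _ (cyc _ _ _ _ uT)) cd).
  case: ifP => // qd ne; exists (next d q), (prev d q); rewrite lamFc //.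
  by split=> //; exact: cycle_prev_next.
have [c [d [cc cd]]] := hw.1; rewrite /linked lkG // => nz.
have [a0 [b0 [u0 [v0 [uab uuv lam0]]]]] : exists a b u v,
    [/\ uniq [:: p; a; b], uniq [:: q; u; v] & lam a b u v <> 0].
  move: nz; rewrite (cycle_sum_pencil (aFd d) (pFd _ cd) cc); case: ifP => // pc.
  have uT := cycle_prev_next cc pc; rewrite -cycle_sum_tri // swap => nz.
  have [u [v [uuv ne]]] := lam_linked _ _ _ uT cd nz.
  by exists (next c p), (prev c p), u, v.
have neq3 k (x y z : 'I_k) : uniq [:: x; y; z] -> [/\ y != x, z != x & y != z].
  by rewrite /= !inE negb_or => /andP[/andP[h1 h2] /andP[h3 _]]; rewrite !(eq_sym _ x).
have [a0p b0p a0b0] := neq3 _ _ _ _ uab; have [u0q v0q u0v0] := neq3 _ _ _ _ uuv.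
have inC k (x y : 'I_k) : (y \in ~: [set x]%SET) = (y != x) by rewrite !inE.
(* Additivity in both pairs writes [lam] as the minors of the matrix with entries [lam a0 a u0 u],
   whose row [a0] is zero. *)
have lamA a b u v : a != p -> b != p -> u != q -> v != q ->
    lam a b u v = lam a0 b u0 v - lam a0 a u0 v - lam a0 b u0 u + lam a0 a u0 u.
  move=> ap bp uq vq; rewrite (lamBl a b a0) // (lamBr a0 b u v u0) //.
  by rewrite (lamBr a0 a u v u0) //; ring.
have [||u|a b u v|l [r [rho [[l0 rl rhol] rs rhos rE]]]] :=
  @staircase _ _ (~: [set p])%SET (~: [set q])%SET (fun a u => lam a0 a u0 u) a0 u0.
- by rewrite inC.
- by rewrite inC.
- by rewrite lam_refll.
- by rewrite !inC => *; rewrite -lamA // lam_le1.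
have lamE a b u v : a != p -> b != p -> u != q -> v != q -> lam a b u v =
    (rho v < r a)%N%:Z - (rho v < r b)%N%:Z + (rho u < r b)%N%:Z - (rho u < r a)%N%:Z.
  by move=> ap bp uq vq; rewrite lamA // rE // inC.
(* With l = 1 all row ranks are 0 and [lam] vanishes, against the linked triangles found above. *)
have l2 : (2 <= l)%N.
  rewrite ltnNge; apply/negP => l1; apply: lam0; rewrite lamE //.
  have r0 a : a != p -> r a = 0%N.
    move=> ap; have := rl a; rewrite inC ap => /(_ isT)/leq_trans/(_ l1).
    by rewrite ltnS leqn0 => /eqP.
  by rewrite !r0.
exists l; split.
  have := card_rank_classes rhos; have := card_rank_classes rs.
  rewrite !cardsC1 !card_ord l2 /=; exact: leq_minn_pred.
exists (rank_class (~: [set p])%SET r), (rank_class (~: [set q])%SET rho); split.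
- split; first exact: rank_class_partition.
  move=> i j x y /rank_classP[] /[!inC] xp ri /rank_classP[] /[!inC] yp rj /eqP xy.
  have uT := utri _ _ _ _ xp yp xy; split.
    move=> [e ce]; rewrite /linked lkG ?cyc // swap => ne ij.
    have [u [v [uT' ne']]] := lam_linked _ _ _ uT ce ne; apply: ne'.
    have [uq vq _] := neq3 _ _ _ _ uT'.
    by rewrite lamE // ri rj ij subrr add0r subrr.
  move=> ij; have rxy : r x != r y by rewrite ri rj; apply/eqP => /val_inj.
  (* A linked triangle quv: u distinguishes the rows x and y, and v, of the top rank l - 1, lies in
     no lower set. *)
  have ml : (minn (r x) (r y) < l)%N by rewrite gtn_min rl ?inC.
  have [u uC ru] := rhos _ ml; have [v vC rv] := rhos l.-1 (ltac:(by rewrite prednK)).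
  move: uC vC; rewrite !inC => uq vq.
  have lv a : a != p -> (rho v < r a)%N = false.
    by move=> ap; rewrite rv ltnNge -ltnS prednK // rl ?inC.
  have ne : lam x y u v <> 0.
    by rewrite lamE // !lv // ru subrr add0r; exact: minn_jump.
  have uv : u != v by apply/eqP => e; apply: ne; rewrite e lam_reflr.
  have uT' := utri _ _ _ _ uq vq uv.
  by exists [:: q; u; v]; [exact: cyc|rewrite /linked -lamLk].
- split; first exact: rank_class_partition.
  move=> i j u v /rank_classP[] /[!inC] uq ri /rank_classP[] /[!inC] vq rj /eqP uv.
  have uT := utri _ _ _ _ uq vq uv; split.
    move=> [e ce]; rewrite /linked lkH ?cyc //.
    rewrite (cycle_sum_pencil (aFd _) (pFd _ (cyc _ _ _ _ uT)) ce); case: ifP => // pe.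
    have [xp yp _] := neq3 _ _ _ _ (cycle_prev_next ce pe).
    rewrite -lamFd // lamE // ri rj => ne ij; apply: ne; rewrite ij.
    by rewrite subrK subrr.
  move=> ij; have ruv : rho u != rho v by rewrite ri rj; apply/eqP => /val_inj.
  (* A linked triangle pxy: x has rank 0, hence an empty lower set, and y distinguishes the columns
     u and v. *)
  have ml : (maxn (rho u) (rho v) < l)%N by rewrite gtn_max !rhol ?inC.
  have [y yC ry] := rs _ ml; have [x xC rx] := rs 0%N l0.
  move: xC yC; rewrite !inC => xp yp.
  have ne : lam x y u v <> 0.
    rewrite lamE // rx ry !ltn0 sub0r subr0 addrC; exact: maxn_jump.
  have xy : x != y by apply/eqP => e; apply: ne; rewrite e lam_refll.
  have xT := utri _ _ _ _ xp yp xy.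
  by exists [:: p; x; y]; [exact: cyc|rewrite /linked lkH ?cyc // cycle_sum_tri // -lamFd].
- move=> j k jk /=; have kl := ltn_ord k.
  set O := (\bigcup_(i < l | (j <= i < k)%N) _)%SET; set I := (_ :|: _)%SET.
  have OE : O = [set u in ~: [set q] | (j <= rho u < k)%N]%SET.
    exact: (bigcup_rank_class rhol (fun i => (j <= i < k)%N)).
  have IE : I = (~: [set q] :\: O)%SET.
    rewrite /I (bigcup_rank_class rhol (fun i => (i < j)%N)).
    rewrite (bigcup_rank_class rhol (fun i => (k <= i)%N)) OE.
    apply/setP => u; rewrite !inE; case: (u != q) => //=; rewrite !andbT.
    by rewrite negb_and -ltnNge -leqNgt.
  split=> // xj xk /rank_classP[] /[!inC] xp rj /rank_classP[] /[!inC] yp rk.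
  have xy : xj != xk by apply: contraTneq jk => e; rewrite -rj e rk ltnn.
  have uT := utri _ _ _ _ xp yp xy.
  (* Members of the two parts of the star: rank j is in O, and rank k is the first one beyond it. *)
  have [u1 u1E u1r] := rhos j (ltn_trans jk kl); have [v1 v1E v1r] := rhos k kl.
  rewrite IE; apply: (@star_of_form _ _ _ _ _ _ (Fc [:: p; xj; xk]) u1 v1).
  + exact: aFc.
  + exact/pFc/cyc.
  + by move=> e ce; rewrite lkG ?cyc // swap.
  + move=> u v uq vq; rewrite -lamFc // lamE // rj rk.
    have memO w : w != q -> (w \in O)%:Z = (rho w < k)%N%:Z - (rho w < j)%N%:Z.
      by move=> wq; rewrite OE !inE wq; apply: itv_indicator; exact: ltnW.
    by rewrite (memO u uq) (memO v vq); exact: four_terms.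
  + by rewrite OE !inE eqxx.
  + by rewrite OE inE u1E u1r leqnn jk.
  + by rewrite -inC.
  + by rewrite OE inE v1r ltnn !andbF.
- move=> j k jk /=; have kl := ltn_ord k.
  set J := (\bigcup_(i < l | (j < i <= k)%N) _)%SET; set P := (_ :|: _)%SET.
  (* The bounds are shifted by one to the half-open form used in [itv_indicatorN]. *)
  have JE : J = [set a in ~: [set p] | (j.+1 <= r a < k.+1)%N]%SET.
    exact: (bigcup_rank_class rl (fun i => (j < i <= k)%N)).
  have PE : P = (~: [set p] :\: J)%SET.
    rewrite /P (bigcup_rank_class rl (fun i => (i <= j)%N)).
    rewrite (bigcup_rank_class rl (fun i => (k < i)%N)) JE.
    apply/setP => a; rewrite !inE; case: (a != p) => //=; rewrite !andbT.
    by rewrite negb_and -ltnNge -leqNgt.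
  split=> // yj yk /rank_classP[] /[!inC] uq rj /rank_classP[] /[!inC] vq rk.
  have uv : yj != yk by apply: contraTneq jk => e; rewrite -rj e rk ltnn.
  have uT := utri _ _ _ _ uq vq uv.
  have [a1 a1E a1r] := rs 0%N l0; have [b1 b1E b1r] := rs k kl.
  (* [star_of_form] describes the last part of the star as a complement, here that of P. *)
  have JE' : J = (~: [set p] :\: P)%SET.
    by apply/setP => a; rewrite PE JE !inE; case: (a != p); rewrite ?andbF ?andbT //= ?andbT negbK.
  rewrite [X in links_in_star _ _ _ _ X]JE'.
  apply: (@star_of_form _ _ _ _ _ _ (Fd [:: q; yj; yk]) a1 b1).
  + exact: aFd.
  + exact/pFd/cyc.
  + by move=> e ce; rewrite lkH ?cyc.
  + move=> a b ap bp; rewrite -lamFd // lamE // rj rk.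
    have memP w : w != p -> (w \in P)%:Z = (k < r w)%N%:Z + 1 - (j < r w)%N%:Z.
      by move=> wp; rewrite PE JE !inE wp andbT; apply: itv_indicatorN; exact: ltnW.
    by rewrite (memP a ap) (memP b bp); exact: four_termsN.
  + by rewrite PE !inE eqxx andbF.
  + by rewrite PE JE !inE -inC a1E a1r.
  + by rewrite -inC.
  + by rewrite PE JE !inE -inC b1E b1r jk leqnn.
Qed.
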